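(* Let $f$ be a hyperbolic polynomial of degree $N$ with real Julia set $J(f)$ and let $0\le t\le 2$. For $n\ge 1$ put $T=f^n$, and for $x\in J(f)$ let $J(x)=J_T(x)$ be the $N^n\times N^n$ Jacobi matrix of the probability measure $\mu_x$ that gives each $\lambda$ with $T(\lambda)=x$ a mass proportional to $|T'(\lambda)|^{-t}$. Then there exists a constant $C<\infty$, independent of $n$, such that for all $n\ge1$ and all $x_1,x_2\in J(f)$ $$\|J(x_1)-J(x_2)\|\le C\,|x_1-x_2| .$$
   Context: $f^n$ denotes the $n$-th iterate of $f$, and $\deg f=N\ge 2$. The Julia set $J(f)$ is the nonempty compact set of points that do not go to infinity under forward iteration of $f$; it is assumed to lie in $\mathbb R$. Normalization: $J(f)\subset[-\xi,\xi]$ and $f^{-1}([-\xi,\xi])\subset[-\xi,\xi]$, $\xi>0$. The polynomial $f$ is hyperbolic (expanding) if none of its critical points $c_i$ (zeros of $f'$) lies in $J(f)$; in this situation $|f(c_i)|>\xi$ for all $i$. Hence every $x\in[-\xi,\xi]$ has exactly $d=N^n$ distinct real preimages $\lambda_1(x)<\dots<\lambda_d(x)$ under $T=f^n$. Measure: $\mu_x=\sigma\sum_{k=1}^d|T'(\lambda_k(x))|^{-t}\delta_{\lambda_k(x)}$, with $1/\sigma=\sum_{k=1}^d|T'(\lambda_k(x))|^{-t}$. Equivalently, with $\phi=-t\log|f'|$, $\mathcal L_\phi\psi(x)=\sum_{f(\lambda)=x}e^{\phi(\lambda)}\psi(\lambda)$ and $G_\phi\mu=\mathcal L_\phi^*\mu/\|\mathcal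 L_\phi^*\mu\|$, one has $\mu_x=G_\phi^n\delta_x$. Jacobi matrix: $J(x):\mathbb C^d\to\mathbb C^d$ is the tridiagonal symmetric matrix of multiplication by the independent variable $\lambda$ on $L^2(\mu_x)$, written in the basis of orthonormal polynomials $P_0=1,P_1,\dots,P_{d-1}$ (with $\deg P_k=k$ and positive leading coefficients) of $\mu_x$. The norm is the operator norm. *)

(* Defs.v *)
From HB Require Import structures.
From mathcomp Require Import all_boot all_order all_algebra.
From mathcomp Require Import all_classical all_reals all_analysis.
From mathcomp Require Export complex.

Set Implicit Arguments.
Unset Strict Implicit.
Unset Printing Implicit Defensive.

Import Order.TTheory GRing.Theory Num.Theory.
Import numFieldNormedType.Exports.

Local Open Scope classical_set_scope.
Local Open Scope complex_scope.
Local Open Scope ring_scope.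

Section Dynamics.
Context {R : realType}.
Local Notation C := R[i].

(* The R-valued modulus of a complex number; the generic [`|z|] is C-valued. *)
Definition modulus (z : C) : R := Normc.normc z.

Definition poly_iter (f : {poly C}) (n : nat) : {poly C} :=
  iter n (fun g => f \Po g) 'X.

(* The points whose orbit does not tend to infinity, among all complex points.
   In general this is the filled Julia set; it coincides with the Julia set
   when it is contained in the real line. *)
Definition julia (f : {poly C}) : set C :=
  [set z | ~ (modulus (iter n (fun w => f.[w]) z) @[n --> \oo] --> +oo)].

Definition real_line : set C := range (fun r : R => r%:C).

Definition real_segment (xi : R) : set C :=
  [set r%:C | r in [set r : R | - xi <= r <= xi]].

Definition normalized (f : {poly C}) (xi : R) : Prop :=
  [/\ 0 < xi,
      julia f `<=` real_segment xi &
      (fun z => f.[z]) @^-1` real_segment xi `<=` real_segment xi].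

Definition hyperbolic (f : {poly C}) : Prop :=
  forall c : C, root f^`() c -> ~ julia f c.

End Dynamics.

Section DiscreteMeasure.
Context {R : realType}.
Local Notation C := R[i].

Definition preimage_weight (T : {poly C}) (t : R) (l : C) : R :=
  modulus T^`().[l] `^ (- t).

(* A finitely supported measure on C is represented by its mass function. *)
Definition preimage_measure (T : {poly C}) (t : R) (x l : C) : R :=
  if T.[l] == x then
    preimage_weight T t l /
      \sum_(k \in [set k | T.[k] = x]) preimage_weight T t k
  else 0.

Definition integral_mass (mu : C -> R) (g : C -> C) : C :=
  \sum_(l \in [set: C]) ((mu l)%:C * g l).

Definition L2_inner (mu : C -> R) (p q : {poly C}) : C :=
  integral_mass mu (fun l => p.[l] * (q.[l])^*%C).

(* In the order of R[i], [0 < z] means that z is a positive real. *)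
Definition orthonormal_polynomials (mu : C -> R) (d : nat)
    (P : 'I_d -> {poly C}) : Prop :=
  [/\ forall k, size (P k) = k.+1,
      forall k, 0 < lead_coef (P k) &
      forall j k, L2_inner mu (P j) (P k) = (j == k)%:R].

Definition multiplication_matrix (mu : C -> R) (d : nat)
    (P : 'I_d -> {poly C}) : 'M[C]_d :=
  \matrix_(i < d, j < d) L2_inner mu ('X * P j) (P i).

(* When mu has at least d atoms, the orthonormal polynomials of degree < d
   exist and are unique, so this selects the unique matrix in the set; when mu
   has exactly d atoms they form a basis of L^2(mu). *)
Definition jacobi_matrix (mu : C -> R) (d : nat) : 'M[C]_d :=
  xget 0 [set J | exists2 P : 'I_d -> {poly C},
                    orthonormal_polynomials mu P &
                    J = multiplication_matrix mu P].

End DiscreteMeasure.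

Section OperatorNorm.
Context {R : realType}.
Local Notation C := R[i].

Definition euclidean_norm (d : nat) (v : 'cV[C]_d) : R :=
  Num.sqrt (\sum_(i < d) modulus (v i 0) ^+ 2).

Definition operator_norm (d : nat) (A : 'M[C]_d) : R :=
  sup [set euclidean_norm (A *m v) | v in
        [set v : 'cV[C]_d | euclidean_norm v <= 1]].

End OperatorNorm.

(* Main.v *)
Require Import Defs.
From mathcomp Require Import all_boot all_order all_algebra.
From mathcomp Require Import all_classical all_reals all_analysis.
From mathcomp Require Import polyrcf complex ring lra zify.

Set Implicit Arguments.
Unset Strict Implicit.
Unset Printing Implicit Defensive.

Import Order.TTheory GRing.Theory Num.Theory.
Import numFieldNormedType.Exports.

Local Open Scope classical_set_scope.
Local Open Scope complex_scope.
Local Open Scope ring_scope.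

(** Write T = f^n and d = N^n. The measures attached to x and y live on the
    disjoint fibres of T over x and y, so they are compared through
    polynomials only, by identities involving the two points x and y and no
    derivative with respect to x.

    Real fibres force f to be a real polynomial F, and hyperbolicity gives
    geometry. Let [m - r0, m + r0] be the convex hull of the Julia set. At
    the critical points between consecutive roots of F = m - r0, and at two
    points just outside the hull, F - m has modulus at least rho > r > r0
    with alternating signs, all these points lying in [m - r, m + r]
    ([hull_bands]). A polynomial of degree N with such full swings satisfies
    a Bernstein inequality in reverse ([reverse_bernstein]):
    N^2 (rho^2 - (F l - m)^2) <= (F' l)^2 (r^2 - (l - m)^2).
    Hence the height h l = r^2 - (l - m)^2 satisfies
    h (F l) <= theta^2 (F' l)^2 h l, where theta = r / (rho N). Everything
    that follows rests on N theta = r / rho < 1.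

    The d preimages of x are indexed by words. Iterating the contraction gives
    |T'| >= c theta^-n at the preimages, distortion bounded by exp (B |x - y|)
    uniformly in n ([distortion]), and the kernel estimate
    1 / |T' (lam_u)| <= K theta^j |lam_u - lam'_v|, where lam_u lies over x,
    lam'_v over y, and the common prefix of the words u and v leaves j > 0
    letters ([kernel_bound]). At most N^j words v are at depth j from u, so the sums
    over v of theta^j are bounded by 1 / (1 - N theta) ([sum_depth_le]).

    Let P_k and Q_k be the orthonormal polynomials over x and over y. Lagrange
    interpolation at the fibre over y, evaluated at a point of the fibre over x,
    carries the factor T - y = x - y. Hence the difference of the inner
    products of Q_i and P_j over x and over y is a bilinear form with a
    kernel of size O(|x - y| theta^j), bounded by Schur's test
    ([compare_inner], [weight_comparison]). The restriction t <= 2 is what lets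
    this kernel absorb the square roots of quotients of masses |T'|^-t, which
    are at most the larger of 1 and a quotient of slopes.

    Finally the inner products of Q_j with P_j and with P_(j-1) are expressed by
    the two highest coefficients of these polynomials. Their closeness over x and
    over y bounds the difference of the Jacobi entries, which are functions of
    those coefficients ([jacobi_close]); a tridiagonal matrix has norm at most
    three times its largest entry. *)

Local Notation re := (@complex.Re _).
Local Notation im := (@complex.Im _).

(** * Trigonometric functions on an interval *)

Section CirclePoint.
Context {R : realType}.
Local Notation C := R[i].

(** For [`|l| <= r] this is exp (i th) with r cos th = l and 0 <= th <= pi, which
    turns trigonometric functions of th into functions of l. *)
Definition circle_point (r l : R) : C :=
  (l / r) +i* Num.sqrt (1 - (l / r) ^+ 2).

Lemma norm_circle_pointX (r l : R) n : 0 < r -> `|l| <= r ->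
  re (circle_point r l ^+ n) ^+ 2 + im (circle_point r l ^+ n) ^+ 2 = 1.
Proof.
move=> r0 hl; have h : 0 <= 1 - (l / r) ^+ 2.
  have : `|l / r| <= 1 by rewrite normrM normfV (gtr0_norm r0) ler_pdivrMr // mul1r.
  by rewrite ler_norml => /andP[? ?]; nra.
elim: n => [|n ih]; first by rewrite expr0 /= expr1n expr0n addr0.
rewrite (exprS (circle_point r l)); move: (circle_point r l ^+ n) ih => [u v] /= ih.
have := sqr_sqrtr h; move: (Num.sqrt _) => s; move: (l / r) => c hs.
have -> : (c * u - s * v) ^+ 2 + (c * v + s * u) ^+ 2 =
  (c ^+ 2 + s ^+ 2) * (u ^+ 2 + v ^+ 2) by ring.
by rewrite ih hs mulr1 addrC subrK.
Qed.

Lemma circle_pointX_continuous (r : R) n :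
  continuous (fun l => re (circle_point r l ^+ n)) /\
  continuous (fun l => im (circle_point r l ^+ n)).
Proof.
have cl : continuous (fun l : R => l / r) by move=> l; apply: cvgMl; exact: cvg_id.
have cs : continuous (fun l : R => Num.sqrt (1 - (l / r) ^+ 2)).
  move=> l; apply: (@cvg_comp _ _ _ (fun l => 1 - (l / r) ^+ 2) Num.sqrt); last first.
    exact: sqrt_continuous.
  by apply: cvgB; [exact: cvg_cst|apply: cvgM; exact: cl].
elim: n => [|n [cu cv]].
  by split=> l; exact: cvg_cst.
have -> : (fun l => re (circle_point r l ^+ n.+1)) =
   (fun l => l / r * re (circle_point r l ^+ n)
      - Num.sqrt (1 - (l / r) ^+ 2) * im (circle_point r l ^+ n)).
  by apply/funext => l; rewrite (exprS (circle_point r l)); case: (circle_point r l ^+ n).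
have -> : (fun l => im (circle_point r l ^+ n.+1)) =
   (fun l => l / r * im (circle_point r l ^+ n)
      + Num.sqrt (1 - (l / r) ^+ 2) * re (circle_point r l ^+ n)).
  by apply/funext => l; rewrite (exprS (circle_point r l)); case: (circle_point r l ^+ n).
split=> l.
  by apply: cvgB; apply: cvgM; [exact: cl|exact: cu|exact: cs|exact: cv].
by apply: cvgD; apply: cvgM; [exact: cl|exact: cv|exact: cs|exact: cu].
Qed.

Lemma norm_re_circle_lt (r rho a b l : R) n : 0 < r -> 0 < rho ->
  a ^+ 2 + b ^+ 2 < rho ^+ 2 -> `|l| <= r ->
  `|re ((a +i* b) * circle_point r l ^+ n)| < rho.
Proof.
move=> r0 rho0 ab lr; have := norm_circle_pointX n r0 lr.
case: (_ ^+ n) => u v /= uv.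
rewrite -(ltr_pXn2r (n := 2)) ?nnegrE // ?ltW //.
rewrite real_normK ?num_real //; apply: le_lt_trans ab.
rewrite -[leRHS]mulr1 -uv -subr_ge0.
have -> : (a ^+ 2 + b ^+ 2) * (u ^+ 2 + v ^+ 2) - (a * u - b * v) ^+ 2 =
  (a * v + b * u) ^+ 2 by ring.
exact: sqr_ge0.
Qed.

(** A function Re (gam z^n) of amplitude |gam| < rho stays strictly between
    -rho and rho, so [g] must meet it whenever it passes from beyond one of these
    values to beyond the other. *)
Lemma crossing (g : {poly R}) n (r rho a b l0 l1 : R) :
  0 < r -> 0 < rho -> - r <= l0 -> l0 < l1 -> l1 <= r ->
  rho <= `|g.[l0]| -> rho <= `|g.[l1]| -> g.[l0] * g.[l1] < 0 ->
  a ^+ 2 + b ^+ 2 < rho ^+ 2 ->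
  exists2 l, l0 < l < l1 & g.[l] = re ((a +i* b) * circle_point r l ^+ n).
Proof.
move=> r0 rho0 rl0 l01 l1r g0 g1 gg ab.
pose c l := re ((a +i* b) * circle_point r l ^+ n).
have cE l : c l = a * re (circle_point r l ^+ n) - b * im (circle_point r l ^+ n).
  by rewrite /c; case: (circle_point r l ^+ n).
have c_lt l : `|l| <= r -> `|c l| < rho by exact: norm_re_circle_lt.
have hr l : l0 <= l -> l <= l1 -> `|l| <= r by move=> h1 h2; rewrite ler_norml; lra.
pose h l := g.[l] - c l.
have ch : continuous h.
  have [cu cv] := circle_pointX_continuous r n.
  move=> l; apply: cvgB; first exact: continuous_horner.
  rewrite /c; under eq_fun do rewrite -/(c _) cE.
  rewrite -/(c l) cE; apply: cvgB; apply: cvgMr; [exact: cu|exact: cv].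
have hh : h l0 * h l1 < 0.
  have := c_lt l0 (hr _ (lexx _) (ltW l01)); have := c_lt l1 (hr _ (ltW l01) (lexx _)).
  rewrite /h; move: (c l0) (c l1) => c0 c1 /ltr_normlP[? ?] /ltr_normlP[? ?].
  case: (ltrgt0P g.[l0]) gg g0 => [g00|g00|->]; last by rewrite mul0r ltxx.
    rewrite pmulr_rlt0 // => g10 g0; rewrite (ltr0_norm g10) in g1.
    by rewrite pmulr_rlt0; lra.
  rewrite nmulr_rlt0 // => g10 g0; rewrite (gtr0_norm g10) in g1.
  by rewrite nmulr_rlt0; lra.
have [l] : exists2 l, l \in `[l0, l1] & h l = 0.
  apply: IVT; [exact: ltW|by apply: continuous_subspaceT|].
  move: (h l0) (h l1) hh => {h ch} u v; rewrite ge_min le_max.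
  case: (ltrgt0P u) => [u0|u0|->]; last by rewrite mul0r ltxx.
    by rewrite pmulr_rlt0 // => /ltW ->; rewrite orbT.
  by rewrite nmulr_rlt0 // => /ltW ->; rewrite orbT.
rewrite in_itv /= => /andP[le0 le1] hl; exists l; last by apply/eqP; rewrite -subr_eq0 -hl.
rewrite !lt_neqAle le0 le1 !andbT; apply/andP; split; apply/eqP => E.
  by rewrite E hl mul0r ltxx in hh.
by rewrite -E hl mulr0 ltxx in hh.
Qed.

End CirclePoint.

(** * The reverse Bernstein inequality *)

Section TrigComparison.
Context {R : realType}.
Local Notation C := R[i].

(** The polynomial in z that equals
    z^n (g (r (z + 1/z) / 2) - (gam z^n + gam' z^-n) / 2). Its zeros on the unit
    circle are the crossings of g with a trigonometric function when gam' is
    the conjugate of gam. *)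
Definition trig_gap (g : {poly R}) n (r : R) (gam gam' : C) : {poly C} :=
  \sum_(k < n.+1) ((g`_k * (r / 2) ^+ k)%:C *: (('X^2 + 1) ^+ k * 'X^(n - k)))
  - (gam / 2) *: 'X^(n + n) - (gam' / 2)%:P.

Lemma size_trig_gap g n r gam gam' : (size (trig_gap g n r gam gam') <= (n + n).+1)%N.
Proof.
rewrite /trig_gap (leq_trans (size_polyD _ _)) // geq_max; apply/andP; split; last first.
  by rewrite size_polyN (leq_trans (size_polyC_leq1 _)).
rewrite (leq_trans (size_polyD _ _)) // geq_max; apply/andP; split; last first.
  by rewrite size_polyN (leq_trans (size_scale_leq _ _)) // size_polyXn.
apply: (leq_trans (size_sum _ _ _)); apply/bigmax_leqP => k _.
rewrite (leq_trans (size_scale_leq _ _)) // (leq_trans (size_polyMleq _ _)) //.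
have hk : (size (('X^2 + 1 : {poly C}) ^+ k) <= (2 * k).+1)%N.
  rewrite (leq_trans (size_poly_exp_leq _ _)) //.
  by rewrite -['X^2 + 1]/('X^2 + 1%:P) size_XnaddC //; lia.
have := ltn_ord k; move: (nat_of_ord k) hk => {k} k.
by move: (size _) => j hk kn; rewrite size_polyXn; lia.
Qed.

Lemma horner_trig_gap (g : {poly R}) n (r : R) (gam gam' z : C) : (size g <= n.+1)%N -> z != 0 ->
  (trig_gap g n r gam gam').[z] =
  z ^+ n * ((map_poly (real_complex R) g).[(r / 2)%:C * (z + z^-1)]
             - (gam * z ^+ n + gam' * z ^- n) / 2).
Proof.
move=> sg z0.
rewrite [in RHS](@horner_coef_wide _ n.+1) ?size_map_poly // /trig_gap !hornerE horner_sum.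
rewrite mulrBr [in RHS]mulr_sumr -!addrA; congr (_ + _); last first.
  rewrite exprD; have zn : z ^+ n != 0 by rewrite expf_neq0.
  by field.
apply: eq_bigr => k _; rewrite !hornerE coef_map /= rmorphM rmorphXn /=.
have kn : (k <= n)%N by rewrite -ltnS.
have -> : z ^+ n = z ^+ k * z ^+ (n - k) by rewrite -exprD subnKC.
rewrite exprMn.
have -> : z ^+ 2 + 1 = z * (z + z^-1) by rewrite mulrDr divff // expr2.
by rewrite exprMn; ring.
Qed.

(** The factor z^n in front contributes n times the bracket of [trig_gap]; added
    to the derivative of the trigonometric part it cancels the gam' terms. *)
Lemma horner_deriv_trig_gap (g : {poly R}) n (r : R) (gam gam' z : C) : (size g <= n.+1)%N -> z != 0 ->
  z * (trig_gap g n r gam gam')^`().[z] =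
  z ^+ n * ((r / 2)%:C * (z - z^-1)
              * (map_poly (real_complex R) g)^`().[(r / 2)%:C * (z + z^-1)]
            + n%:R * (map_poly (real_complex R) g).[(r / 2)%:C * (z + z^-1)]
            - n%:R * gam * z ^+ n).
Proof.
move=> sg z0; set w := (r / 2)%:C * (z + z^-1).
have Dg : (map_poly (real_complex R) g)^`().[w] =
    \sum_(k < n.+1) (g`_k)%:C * (w ^+ k.-1 *+ k).
  have -> : map_poly (real_complex R) g = \sum_(k < n.+1) (g`_k)%:C *: 'X^k.
    apply/polyP => i; rewrite coef_map coef_sum /=.
    under eq_bigr do rewrite coefZ coefXn.
    case: (ltnP i n.+1) => ni.
      rewrite (bigD1 (Ordinal ni)) //= eqxx mulr1 big1 ?addr0 // => k /negPf.
      by rewrite eq_sym => kn; rewrite (_ : (i == k) = false) ?mulr0 // -kn -val_eqE.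
    rewrite nth_default ?(leq_trans sg) // big1 // => k _.
    by rewrite gtn_eqF ?mulr0 // (leq_trans (ltn_ord k)).
  rewrite raddf_sum /= horner_sum; apply: eq_bigr => k _.
  by rewrite derivZ derivXn hornerZ hornerMn hornerXn.
rewrite Dg [in RHS](@horner_coef_wide _ n.+1) ?size_map_poly // /trig_gap.
rewrite !derivB derivC subr0 derivZ derivXn raddf_sum /= hornerD hornerN hornerZ hornerMn.
rewrite hornerXn horner_sum !mulrBr; congr (_ - _); last first.
  case: n {sg Dg} => [|n]; first by rewrite mulr0n !mul0r !mulr0.
  rewrite -[_ *+ (_ + _)]mulr_natr natrD (exprD z n n.+1 : z ^+ (n.+1 + n.+1).-1 = _).
  by rewrite exprS; field.
rewrite mulr_sumr (mulr_sumr _ _ _ (_ - _)) (mulr_sumr _ _ _ n%:R) -big_split /= mulr_sumr.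
apply: eq_bigr => k _; rewrite coef_map /= rmorphM rmorphXn /=.
have kn : (k <= n)%N by rewrite -ltnS.
have nE : n%:R = k%:R + (n - k)%:R :> C by rewrite -natrD subnKC.
have -> : z ^+ n = z ^+ k * z ^+ (n - k) by rewrite -exprD subnKC.
have zm m : z * (z ^+ m.-1 *+ m) = m%:R * z ^+ m.
  by case: m => [|m]; rewrite ?mulr0n ?mulr0 ?mul0r // mulrnAr -exprS mulr_natl.
have zy : z ^+ 2 + 1 = z * (z + z^-1) by rewrite mulrDr divff // expr2.
have -> : ((g`_k)%:C * (r / 2)%:C ^+ k *:
    (('X^2 + 1) ^+ k * 'X^(n - k)))^`().[z] = (g`_k)%:C * (r / 2)%:C ^+ k *
    (2 * z * ((z ^+ 2 + 1) ^+ k.-1 *+ k) * z ^+ (n - k)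
     + (z ^+ 2 + 1) ^+ k * (z ^+ (n - k).-1 *+ (n - k))).
  rewrite derivZ derivM deriv_exp derivXn derivD derivXn -(polyC1 C) derivC addr0.
  rewrite !(hornerZ, hornerD, hornerM, hornerMn, horner_exp, hornerXn, hornerC).
  by rewrite /= !hornerX expr1 -mulr2n -(mulr_natl z 2) (mulrnAr (2 * z)) expr2.
transitivity ((g`_k)%:C * (r / 2)%:C ^+ k *
    (2 * z * (z * ((z ^+ 2 + 1) ^+ k.-1 *+ k)) * z ^+ (n - k)
     + (z ^+ 2 + 1) ^+ k * (z * (z ^+ (n - k).-1 *+ (n - k))))); first by ring.
rewrite zm zy nE /w !exprMn.
case: (nat_of_ord k) => [|j] /=; first by rewrite !mulr0n; ring.
rewrite -(mulr_natl (z ^+ j * _)) -(mulr_natl ((r / 2)%:C ^+ j * _)) !exprS.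
move: (z ^+ j) (z ^+ (n - j.+1)) ((n - j.+1)%:R) ((z + z^-1) ^+ j) ((r / 2)%:C ^+ j) => *.
by field.
Qed.

Lemma horner_trig_gap_circle (g : {poly R}) n (r a b : R) (w : C) :
  (size g <= n.+1)%N -> w * w^*%C = 1 ->
  (trig_gap g n r (a +i* b) (a -i* b)).[w] =
  w ^+ n * (g.[r * re w] - re ((a +i* b) * w ^+ n))%:C.
Proof.
move=> sg ww; have w0 : w != 0.
  by apply/eqP => w0; move: ww; rewrite w0 mul0r => /esym/eqP; rewrite oner_eq0.
have wV : w^-1 = w^*%C by rewrite -[LHS]mulr1 -ww mulKf.
rewrite horner_trig_gap // -exprVn wV -rmorphXn /= addcJ.
have -> : (a -i* b) = (a +i* b)^*%C by [].
rewrite -rmorphM /= addcJ; congr (_ * _).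
have -> : (r / 2)%:C * (2 * (re w)%:C) = (r * re w)%:C.
  by rewrite !rmorphM /= fmorphV rmorph_nat; field.
rewrite horner_map /= rmorphB /=; congr (_ - _).
by move: (re _) => x; field.
Qed.

(** If the inequality failed at [l], some function Re (gam z^n) with |gam| < rho
    would have the value and the first derivative of [g] at [l]. It crosses [g]
    in each of the n intervals; on the lower semicircle, so does its conjugate.
    The corresponding [trig_gap], of degree at most 2 n, would then have 2 n
    distinct roots, one of which may be the point over [l], and a double root
    there: one root too many. *)
Lemma reverse_bernstein (g : {poly R}) n (r rho l : R) (s : nat -> R) :
  (size g <= n.+1)%N -> 0 < rho -> - r <= s 0%N -> s n <= r ->
  (forall k, (k < n)%N -> s k < s k.+1) ->
  (forall k, (k <= n)%N -> rho <= `|g.[s k]|) ->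
  (forall k, (k < n)%N -> g.[s k] * g.[s k.+1] < 0) ->
  `|l| < r ->
  n%:R ^+ 2 * rho ^+ 2 <=
  n%:R ^+ 2 * g.[l] ^+ 2 + g^`().[l] ^+ 2 * (r ^+ 2 - l ^+ 2).
Proof.
move=> sg rho0 rs0 snr smono sbig salt lr; rewrite leNgt; apply/negP => lt_rho.
have r0 : 0 < r by exact: le_lt_trans lr.
have sle j k : (j <= k)%N -> (k <= n)%N -> s j <= s k.
  elim: k => [|k ih]; first by rewrite leqn0 => /eqP->.
  rewrite leq_eqVlt => /orP[/eqP->//|jk] kn.
  by apply: (le_trans (ih jk (ltnW kn))); exact/ltW/smono.
have n0 : (0 < n)%N.
  case: n lt_rho {sg snr smono sbig salt sle} => // ; rewrite expr0n !mul0r add0r.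
  rewrite ltNge mulr_ge0 ?sqr_ge0 //.
  by case/ltr_normlP: lr => *; nra.
have n0R : n%:R != 0 :> R by rewrite pnatr_eq0 -lt0n.
pose z := circle_point r; pose c := Num.sqrt (1 - (l / r) ^+ 2).
have hc : c ^+ 2 = 1 - (l / r) ^+ 2.
  rewrite sqr_sqrtr // subr_ge0.
  have : `|l / r| <= 1 by rewrite normrM normfV (gtr0_norm r0) ler_pdivrMr // mul1r ltW.
  by rewrite ler_norml => /andP[? ?]; nra.
pose A := g.[l]; pose B := g^`().[l] * r * c / n%:R.
have AB : A ^+ 2 + B ^+ 2 < rho ^+ 2.
  rewrite -(ltr_pM2l (exprn_gt0 2 (_ : 0 < n%:R))) ?ltr0n //.
  apply: le_lt_trans lt_rho; rewrite mulrDr lerD2l /B 3!exprMn exprVn hc.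
  rewrite le_eqVlt; apply/orP; left; apply/eqP; field.
  by rewrite n0R gt_eqF.
pose u := re (z l ^+ n); pose v := im (z l ^+ n).
have uv : u ^+ 2 + v ^+ 2 = 1 by apply: norm_circle_pointX => //; exact: ltW.
(* gam = a + b i is such that gam z^n = A + B i at the point over [l], where A is
   the value of [g] and B is - 1 / n times its angular derivative. *)
pose a := A * u + B * v; pose b := B * u - A * v.
have ab : a ^+ 2 + b ^+ 2 < rho ^+ 2.
  apply: le_lt_trans AB; rewrite -[leRHS]mulr1 -uv le_eqVlt; apply/orP; left; apply/eqP.
  by rewrite /a /b; ring.
have gamz : (a +i* b) * z l ^+ n = A +i* B.
  move: uv; rewrite /a /b /u /v; case: (z l ^+ n) => x y /= uv.
  by simpc; congr (_ +i* _); rewrite -[RHS]mulr1 -uv; ring.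
pose p := trig_gap g n r (a +i* b) (a -i* b).
have zJ x : `|x| <= r -> z x * (z x)^*%C = 1.
  move=> xr; have := norm_circle_pointX 1 r0 xr; rewrite expr1 -/(z x).
  by case: (z x) => x1 x2 /= h; simpc; rewrite -!expr2 h; congr (_ +i* _); ring.
have rez x : r * re (z x) = x by rewrite /= mulrC divfK ?gt_eqF.
have pz x : `|x| <= r -> p.[z x] = (z x) ^+ n * (g.[x] - re ((a +i* b) * z x ^+ n))%:C.
  by move=> xr; rewrite /p horner_trig_gap_circle ?zJ // rez.
have pzJ x : `|x| <= r ->
    p.[(z x)^*%C] = (z x)^*%C ^+ n * (g.[x] - re ((a -i* b) * z x ^+ n))%:C.
  move=> xr; have zJ' : (z x)^*%C * (z x)^*^*%C = 1 by rewrite conjcK mulrC zJ.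
  rewrite (horner_trig_gap_circle r a b sg zJ').
  have -> : re (z x)^*%C = re (z x) by case: (z x).
  rewrite rez -rmorphXn /=; congr (_ * (_ - _)%:C).
  by case: (z x ^+ n) => x1 x2 /=; ring.
have sr k : (k <= n)%N -> - r <= s k /\ s k <= r.
  move=> kn; split; first exact: le_trans rs0 (sle _ _ (leq0n _) kn).
  exact: le_trans (sle _ _ kn (leqnn _)) snr.
have ab' : a ^+ 2 + (- b) ^+ 2 < rho ^+ 2 by rewrite sqrrN.
(* b' = b gives the roots on the upper semicircle, b' = - b those on the lower. *)
have cross (b' : R) : a ^+ 2 + b' ^+ 2 < rho ^+ 2 -> exists L : nat -> R,
    forall k, (k < n)%N -> s k < L k < s k.+1 /\
      g.[L k] = re ((a +i* b') * z (L k) ^+ n).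
  move=> h; suff /choice[L HL] : forall k, exists x, (k < n)%N ->
      s k < x < s k.+1 /\ g.[x] = re ((a +i* b') * z x ^+ n) by exists L.
  move=> k; have [kn|] := boolP (k < n)%N; last by exists 0.
  have [x xs gx] := @crossing _ g n r rho a b' (s k) (s k.+1) r0 rho0 (sr _ (ltnW kn)).1
    (smono _ kn) (sr _ kn).2 (sbig _ (ltnW kn)) (sbig _ kn) (salt _ kn) h.
  by exists x.
have [L HL] := cross b ab; have [L' HL'] := cross (- b) ab'.
have Lr M : (forall k, (k < n)%N -> s k < M k < s k.+1) -> forall k, (k < n)%N -> `|M k| < r.
  move=> HM k kn; have /andP[h1 h2] := HM _ kn.
  by rewrite ltr_norml (le_lt_trans (sr _ (ltnW kn)).1 h1) (lt_le_trans h2 (sr _ kn).2).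
have Linj M : (forall k, (k < n)%N -> s k < M k < s k.+1) -> {in iota 0 n &, injective M}.
  move=> HM j k; rewrite !mem_iota !add0n /= => jn kn MM; apply/eqP.
  have lt j' k' : (j' < k')%N -> (k' < n)%N -> M j' < M k'.
    move=> jk kn'; have /andP[_ h1] := HM _ (ltn_trans jk kn'); have /andP[h2 _] := HM _ kn'.
    exact: lt_trans (lt_le_trans h1 (sle _ _ jk (ltnW kn'))) h2.
  case: (ltngtP j k) => // h; first by have := lt _ _ h kn; rewrite MM ltxx.
  by have := lt _ _ h jn; rewrite MM ltxx.
have HM k : (k < n)%N -> s k < L k < s k.+1 by move=> kn; case: (HL _ kn).
have HM' k : (k < n)%N -> s k < L' k < s k.+1 by move=> kn; case: (HL' _ kn).
have imz x : `|x| < r -> 0 < im (z x).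
  move=> xr; rewrite /= sqrtr_gt0 subr_gt0.
  have : `|x / r| < 1 by rewrite normrM normfV (gtr0_norm r0) ltr_pdivrMr // mul1r.
  by rewrite ltr_norml => /andP[? ?]; nra.
pose rs := [seq z (L k) | k <- iota 0 n] ++ [seq (z (L' k))^*%C | k <- iota 0 n].
have rs_root : all (root p) rs.
  apply/allP => w; rewrite mem_cat => /orP[] /mapP[k]; rewrite mem_iota add0n /= => kn ->.
    by rewrite rootE pz ?ltW ?(Lr L) // (HL _ kn).2 subrr mulr0.
  by rewrite rootE pzJ ?ltW ?(Lr L') // (HL' _ kn).2 subrr mulr0.
have rs_uniq : uniq rs.
  have zinj x y : z x = z y -> x = y by move=> e; rewrite -[x]rez -[y]rez e.
  rewrite cat_uniq !map_inj_in_uniq ?iota_uniq ?andbT //.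
  - apply/hasPn => w /mapP[k]; rewrite mem_iota add0n /= => kn ->.
    apply/mapP => -[j]; rewrite mem_iota add0n /= => jn e.
    have := congr1 im e : - im (z (L' k)) = im (z (L j)).
    have := imz _ (Lr _ HM _ jn); have := imz _ (Lr _ HM' _ kn).
    by move: (im _) (im _) => x y ? ? ?; lra.
  - move=> j k jn kn e; apply: (Linj _ HM' _ _ jn kn); apply: zinj.
    exact: (can_inj (@conjcK _) e).
  - by move=> j k jn kn e; apply: (Linj _ HM _ _ jn kn); exact: zinj.
have p0 : p != 0.
  apply/eqP => p0; have s0r : `|s 0%N| <= r by rewrite ler_norml !(sr 0%N _).1 // (sr 0%N _).2.
  have := pz _ s0r; rewrite p0 horner0 => /esym/eqP; rewrite mulf_eq0 expf_eq0 n0.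
  case/orP => [/eqP z0|/eqP/complexI/eqP].
    by have := zJ _ s0r; rewrite z0 mul0r => /esym/eqP; rewrite oner_eq0.
  rewrite subr_eq0 => /eqP gs; have := sbig 0%N (leq0n _).
  by rewrite gs leNgt norm_re_circle_lt.
have pz0 : root p (z l).
  rewrite rootE pz ?ltW // gamz /= subrr mulr0 //.
(* the choice of B makes the point over [l] a double root *)
have dp0 : p^`().[z l] = 0.
  have zn0 : z l != 0.
    by apply/eqP => e; have := zJ l (ltW lr); rewrite e mul0r => /esym/eqP; rewrite oner_eq0.
  apply: (mulfI zn0); rewrite mulr0 horner_deriv_trig_gap // -(mulrA n%:R) gamz.
  have wV : (z l)^-1 = (z l)^*%C by rewrite -[LHS]mulr1 -(zJ l (ltW lr)) mulKf.
  have wE : (r / 2)%:C * (z l + (z l)^-1) = l%:C.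
    rewrite wV addcJ -[in RHS](rez l) !rmorphM /= fmorphV rmorph_nat.
    by move: (l%:C * _) => ?; field.
  have wE' : (r / 2)%:C * (z l - (z l)^-1) = (r * c)%:C * 'i%C.
    rewrite wV subcJ !rmorphM /= fmorphV rmorph_nat -/c.
    by field.
  rewrite wE wE' deriv_map !horner_map /= -/A [A +i* B]complexE /=.
  have -> : B%:C = (g^`().[l])%:C * (r * c)%:C / n%:R.
    by rewrite /B !rmorphM /= fmorphV rmorph_nat !mulrA.
  apply/eqP; rewrite mulf_eq0; apply/orP; right; apply/eqP.
  by move: (_%:C) => ?; field; rewrite pnatr_eq0 -lt0n.
have /factor_theorem[q pq] := pz0.
have q0 : q != 0 by apply: contraNneq p0 => q0; rewrite pq q0 mul0r.
have qz0 : root q (z l).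
  move: dp0; rewrite pq derivM derivXsubC mulr1 hornerD hornerM hornerXsubC subrr mulr0 add0r.
  by move/eqP.
have rs_q : all (root q) (z l :: [seq w <- rs | w != z l]).
  rewrite /= qz0; apply/allP => w; rewrite mem_filter => /andP[/= wl wrs].
  have := allP rs_root _ wrs; rewrite pq rootM => /orP[//|].
  by rewrite root_XsubC (negPf wl).
have := max_poly_roots q0 rs_q.
rewrite /= filter_uniq // mem_filter /= eqxx /= => /(_ isT).
apply/negP; rewrite -leqNgt.
have := size_trig_gap g n r (a +i* b) (a -i* b); rewrite -/p pq size_Mmonic ?monicXsubC //.
rewrite size_XsubC addn2 /= ltnS => hq; apply: (leq_trans hq).
have := count_predC (pred1 (z l)) rs; rewrite size_filter size_cat !size_map !size_iota.
by rewrite count_uniq_mem // => <-; rewrite -[leqRHS]add1n leq_add // leq_b1.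
Qed.

End TrigComparison.

(** * Expanding bands, inverse branches and distortion *)

(** On [m - r, m + r] the polynomial [F] makes N full swings of alternating sign
    and height at least rho > r about m, one on each band [s k, s k.+1]. The
    core [m - r0, m + r0], which plays the role of the convex hull of the Julia set,
    contains its own preimage. *)
Record expanding_bands {R : realType} (F : {poly R}) (N : nat) (m r0 r rho : R)
    (s : nat -> R) : Prop := ExpandingBands {
  bands_N : (0 < N)%N;
  bands_size : size F = N.+1;
  bands_r0 : 0 <= r0;
  bands_r : r0 < r;
  bands_rho : r < rho;
  bands_s0 : m - r <= s 0%N;
  bands_sN : s N <= m + r;
  bands_lt : forall k, (k < N)%N -> s k < s k.+1;
  bands_big : forall k, (k <= N)%N -> rho <= `|F.[s k] - m|;
  bands_alt : forall k, (k < N)%N -> (F.[s k] - m) * (F.[s k.+1] - m) < 0;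
  bands_inv : forall l, `|F.[l] - m| <= r0 -> `|l - m| <= r0 }.

Lemma geometric_sum_le {R : realFieldType} (q : R) n : 0 <= q -> q < 1 ->
  \sum_(i < n) q ^+ i <= (1 - q)^-1.
Proof.
move=> q0 q1; have q1' : 0 < 1 - q by rewrite subr_gt0.
have e : (1 - q) * (\sum_(i < n) q ^+ i) = 1 - q ^+ n by rewrite -opprB mulNr -subrX1 opprB.
by rewrite -(ler_pM2l q1') e divff ?gt_eqF // lerBlDr lerDl exprn_ge0.
Qed.

Lemma between_itv {R : realDomainType} (a b u : R) : a <= b ->
  (u - a) * (u - b) <= 0 -> a <= u <= b.
Proof. by move=> ab ?; apply/andP; split; rewrite leNgt; apply/negP => ?; nra. Qed.

Lemma between_dist {R : realDomainType} (a b u v : R) :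
  (u - a) * (u - b) <= 0 -> (v - a) * (v - b) <= 0 -> `|u - v| <= `|a - b|.
Proof.
wlog ab : a b / a <= b => [W|/(between_itv ab)/andP[? ?] /(between_itv ab)/andP[? ?]].
  case: (leP a b) => [|/ltW] ab; first exact: W.
  by rewrite (distrC a) (mulrC (u - a)) (mulrC (v - a)); exact: W.
by rewrite (distrC a) (ger0_norm (_ : 0 <= b - a)) ?subr_ge0 // ler_norml; lra.
Qed.

Section Bands.
Context {R : realType}.

Definition branch (F : {poly R}) (s : nat -> R) (k : nat) (y : R) : R :=
  xget 0 [set l | s k < l < s k.+1 /\ F.[l] = y].

Context (F : {poly R}) (N : nat) (m r0 r rho : R) (s : nat -> R).
Context (H : expanding_bands F N m r0 r rho s).
Local Notation psi := (branch F s).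
Local Notation h l := (r ^+ 2 - (l - m) ^+ 2).
Local Notation theta := (r / (rho * N%:R)).

Let r_gt0 : 0 < r. Proof. exact: le_lt_trans (bands_r0 H) (bands_r H). Qed.
Let rho_gt0 : 0 < rho. Proof. exact: lt_trans r_gt0 (bands_rho H). Qed.
Let N_gt0 : 0 < N%:R :> R. Proof. by rewrite ltr0n (bands_N H). Qed.

Lemma bands_le j k : (j <= k)%N -> (k <= N)%N -> s j <= s k.
Proof.
elim: k => [|k ih]; first by rewrite leqn0 => /eqP->.
rewrite leq_eqVlt => /orP[/eqP->//|jk] kn.
by apply: (le_trans (ih jk (ltnW kn))); exact/ltW/(bands_lt H).
Qed.

Lemma band_sub k l : (k < N)%N -> s k < l < s k.+1 -> `|l - m| < r.
Proof.
move=> kN /andP[h1 h2]; rewrite ltr_norml.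
have := bands_le (leq0n k) (ltnW kN); have := bands_le kN (leqnn _).
by have := bands_s0 H; have := bands_sN H; lra.
Qed.

Lemma bands_alt_shift k y : (k < N)%N -> `|y - m| < rho ->
  (F.[s k] - y) * (F.[s k.+1] - y) < 0.
Proof.
move=> kN /ltr_normlP[y1 y2].
have := bands_alt H kN; have := bands_big H (ltnW kN); have := bands_big H kN.
move: (F.[_]) (F.[_]) => a b; case: (ltrgt0P (a - m)) => [a0|a0|->]; last by rewrite mul0r ltxx.
  move=> hb ha; rewrite pmulr_rlt0 // => b0; move: hb; rewrite ltr0_norm // => hb.
  by rewrite pmulr_rlt0; lra.
move=> hb ha; rewrite nmulr_rlt0 // => b0; move: hb; rewrite gtr0_norm // => hb.
by rewrite nmulr_rlt0; lra.
Qed.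

Lemma branchP k y : (k < N)%N -> `|y - m| < rho ->
  s k < psi k y < s k.+1 /\ F.[psi k y] = y.
Proof.
move=> kN yr; suff /(xgetPex 0) : exists l, [set l | s k < l < s k.+1 /\ F.[l] = y] l by [].
have hs := bands_alt_shift kN yr.
have [||l ls /rootP] := @poly_ivtoo _ (F - y%:P) (s k) (s k.+1).
- exact/ltW/(bands_lt H).
- by rewrite !hornerE.
rewrite !hornerE => /eqP; rewrite subr_eq0 => /eqP Fl.
by exists l; split => //; rewrite in_itv in ls.
Qed.

Lemma branch_lt j k y z : (j < k)%N -> (k < N)%N -> `|y - m| < rho -> `|z - m| < rho ->
  psi j y < psi k z.
Proof.
move=> jk kN yr zr; have [/andP[_ h1] _] := branchP (ltn_trans jk kN) yr.
have [/andP[h2 _] _] := branchP kN zr.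
exact: lt_trans (lt_le_trans h1 (bands_le jk (ltnW kN))) h2.
Qed.

Lemma branch_inj (i j : 'I_N) y z : `|y - m| < rho -> `|z - m| < rho ->
  psi i y = psi j z -> i = j.
Proof.
move=> yr zr e; apply/val_inj; case: (ltngtP i j) => // ij.
  by have := branch_lt ij (ltn_ord j) yr zr; rewrite e ltxx.
by have := branch_lt ij (ltn_ord i) zr yr; rewrite e ltxx.
Qed.

(** The branches on the N bands already provide N roots of F - y. *)
Lemma preimage_branch l y : `|y - m| < rho -> F.[l] = y ->
  exists i : 'I_N, l = psi i y.
Proof.
move=> yr Fl; apply: contrapT => nl.
pose rs := l :: [seq psi (i : 'I_N) y | i <- enum 'I_N].
have F0 : F - y%:P != 0.
  rewrite -size_poly_eq0 size_polyDl ?(bands_size H) // size_polyN.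
  by rewrite (leq_ltn_trans (size_polyC_leq1 _)) // ltnS (bands_N H).
have := @max_poly_roots _ _ rs F0; rewrite /= size_map size_enum_ord.
rewrite size_polyDl ?(bands_size H) ?ltnn; last first.
  by rewrite size_polyN (leq_ltn_trans (size_polyC_leq1 _)) // ltnS (bands_N H).
move=> X; suff : false by []; apply: X.
  rewrite /rs /= rootE !hornerE Fl subrr eqxx; apply/allP => w /mapP[i _ ->].
  by rewrite rootE !hornerE (branchP (ltn_ord i) yr).2 subrr.
rewrite map_inj_uniq ?enum_uniq ?andbT; last by move=> i j; exact: branch_inj.
by apply/mapP => -[i _ li]; apply: nl; exists i.
Qed.

Lemma band_branch k l y : (k < N)%N -> `|y - m| < rho -> s k < l < s k.+1 ->
  F.[l] = y -> l = psi k y.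
Proof.
move=> kN yr /andP[l1 l2] Fl; have [i li] := preimage_branch yr Fl.
have [/andP[i1 i2] _] := branchP (ltn_ord i) yr; rewrite -li in i1 i2.
suff -> : k = i by [].
case: (ltngtP k i) => // ki.
  by have := lt_trans (lt_le_trans l2 (bands_le ki (ltnW (ltn_ord i)))) i1; rewrite ltxx.
by have := lt_trans (lt_le_trans i2 (bands_le ki (ltnW kN))) l1; rewrite ltxx.
Qed.

Local Notation core y := (`|y - m| <= r0).

Lemma core_rho y : core y -> `|y - m| < rho.
Proof. by move=> h; have := bands_r H; have := bands_rho H; lra. Qed.

Lemma branch_core k y : (k < N)%N -> core y -> core (psi k y).
Proof.
by move=> kN yc; apply: (bands_inv H); rewrite (branchP kN (core_rho yc)).2.
Qed.

(** Although [F] need not be monotone on a band, its values between two branch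
    points stay between the values at these points: otherwise the intermediate
    value theorem, applied between c and an end of the band, would give a second
    root of F = y or F = z in the band. *)
Lemma band_monotone k y z c : (k < N)%N -> core y -> core z ->
  psi k y < c < psi k z -> (F.[c] - y) * (F.[c] - z) <= 0.
Proof.
move=> kN yc zc /andP[yc' zc'].
have [/andP[y1 y2] Fy] := branchP kN (core_rho yc).
have [/andP[z1 z2] Fz] := branchP kN (core_rho zc).
(* F - z has no sign change to the left of c, nor F - y to its right. *)
have left_z : 0 <= (F.[s k] - z) * (F.[c] - z).
  rewrite leNgt; apply/negP => neg.
  have [||l] := @poly_ivtoo _ (F - z%:P) (s k) c; [lra|by rewrite !hornerE|].
  rewrite in_itv /= => /andP[l1 l2] /rootP; rewrite !hornerE => /eqP; rewrite subr_eq0 => /eqP Fl.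
  have e : l = psi k z by apply: (band_branch kN (core_rho zc) _ Fl); rewrite l1 /=; lra.
  by rewrite e in l2; lra.
have right_y : 0 <= (F.[c] - y) * (F.[s k.+1] - y).
  rewrite leNgt; apply/negP => neg.
  have [||l] := @poly_ivtoo _ (F - y%:P) c (s k.+1); [lra|by rewrite !hornerE|].
  rewrite in_itv /= => /andP[l1 l2] /rootP; rewrite !hornerE => /eqP; rewrite subr_eq0 => /eqP Fl.
  have e : l = psi k y by apply: (band_branch kN (core_rho yc) _ Fl); rewrite l2 andbT; lra.
  by rewrite e in l1; lra.
move: left_z right_y (bands_alt H kN) (bands_big H (ltnW kN)) (bands_big H kN).
move: (core_rho yc) (core_rho zc) => /ltr_normlP[? ?] /ltr_normlP[? ?].
move: F.[c] F.[s k] F.[s k.+1] => u a b.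
case: (ltrgt0P (a - m)) => [a0|a0|->]; last by rewrite mul0r ltxx.
  move=> hz hy; rewrite pmulr_rlt0 // => b0; rewrite (ltr0_norm b0) => ha hb.
  have az : 0 < a - z by lra.
  have by' : b - y < 0 by lra.
  by move: hz hy; rewrite pmulr_rge0 // nmulr_lge0 // => hz hy; rewrite mulr_le0_ge0.
move=> hz hy; rewrite nmulr_rlt0 // => b0; rewrite (gtr0_norm b0) => ha hb.
have az : a - z < 0 by lra.
have by' : 0 < b - y by lra.
by move: hz hy; rewrite nmulr_rge0 // pmulr_lge0 // => hz hy; rewrite mulr_ge0_le0.
Qed.

Lemma reverse_bernstein_bands l : `|l - m| < r ->
  N%:R ^+ 2 * (rho ^+ 2 - (F.[l] - m) ^+ 2) <= F^`().[l] ^+ 2 * h l.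
Proof.
move=> lr; pose g := (F \Po ('X + m%:P)) - m%:P.
have gE x : g.[x] = F.[x + m] - m by rewrite /g !hornerE horner_comp !hornerE.
have g'E x : g^`().[x] = F^`().[x + m].
  rewrite /g derivB derivC subr0 deriv_comp derivD derivX derivC addr0 mulr1.
  by rewrite horner_comp !hornerE.
rewrite mulrBr lerBlDl -[l in F.[l]](subrK m) -[l in F^`().[l]](subrK m) -gE -g'E.
apply: (@reverse_bernstein R g N r rho (l - m) (fun k => s k - m)) => //.
- rewrite (leq_trans (size_polyD _ _)) // geq_max size_polyN.
  rewrite (leq_trans (size_polyC_leq1 _)) // andbT.
  rewrite (leq_trans (size_comp_poly_leq _ _)) // (bands_size H) size_XaddC /=.
  by rewrite muln1.
- by have := bands_s0 H; lra.
- by have := bands_sN H; lra.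
- by move=> k kN; rewrite ltrD2r (bands_lt H).
- by move=> k kN; rewrite gE subrK (bands_big H).
- by move=> k kN; rewrite !gE !subrK (bands_alt H).
Qed.

(** [reverse_bernstein] in terms of the height, after bounding
    r^2 - v^2 by (r / rho)^2 (rho^2 - v^2); the excess of rho over r makes N theta
    smaller than 1. *)
Lemma height_contraction l : `|l - m| < r ->
  h F.[l] <= theta ^+ 2 * (F^`().[l] ^+ 2 * h l).
Proof.
move=> lr; have := reverse_bernstein_bands lr.
rewrite -(ler_pM2l (exprn_gt0 2 (divr_gt0 r_gt0 (mulr_gt0 rho_gt0 N_gt0)))).
apply: le_trans; move: (F.[l] - m) => v.
have -> : theta ^+ 2 * (N%:R ^+ 2 * (rho ^+ 2 - v ^+ 2)) =
    r ^+ 2 - v ^+ 2 * (r / rho) ^+ 2 by field; rewrite !gt_eqF.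
rewrite lerB // ler_piMr ?sqr_ge0 // expr_le1 ?ltW ?divr_gt0 //.
by rewrite ltr_pdivrMr // mul1r (bands_rho H).
Qed.

Lemma deriv_bands_ge : exists2 kap, 0 < kap &
  forall l, core l -> core F.[l] -> kap <= `|F^`().[l]|.
Proof.
exists (N%:R * Num.sqrt (rho ^+ 2 - r0 ^+ 2) / r).
  rewrite divr_gt0 ?mulr_gt0 ?sqrtr_gt0 // subr_gt0.
  by have := bands_r0 H; have := bands_r H; have := bands_rho H; nra.
move=> l lc Fc; have r0_ge0 := bands_r0 H; have r0r := bands_r H; have rrho := bands_rho H.
have lr : `|l - m| < r by lra.
have r_ge0 := ltW r_gt0.
rewrite ler_pdivrMr // -(ler_pXn2r (n := 2)) ?nnegrE ?mulr_ge0 ?ler0n ?sqrtr_ge0 //.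
rewrite exprMn sqr_sqrtr; last by nra.
have := reverse_bernstein_bands lr; rewrite exprMn real_normK ?num_real //.
have hF : (F.[l] - m) ^+ 2 <= r0 ^+ 2 by rewrite -real_normK ?num_real // ler_pXn2r ?nnegrE.
move=> hb; apply: le_trans (le_trans hb _).
  by rewrite ler_wpM2l ?sqr_ge0 // lerD2l lerN2.
by rewrite ler_wpM2l ?sqr_ge0 // lerBlDr lerDl sqr_ge0.
Qed.

(** [F] is composed on the right so that the recursion peels off the letter of a
    word whose branch is applied last. *)
Definition iterp (n : nat) : {poly R} := iter n (fun g => g \Po F) 'X.

(** Iterated products of ordinals, so that words inherit a finType structure and
    sums over words split along the first letter. *)
Fixpoint word (n : nat) : finType :=
  if n is k.+1 then ('I_N * word k)%type else unit.

Fixpoint point (n : nat) : word n -> R -> R :=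
  match n return word n -> R -> R with
  | 0 => fun _ x => x
  | k.+1 => fun w x => psi w.1 (point w.2 x)
  end.

Fixpoint slope (n : nat) : word n -> R -> R :=
  match n return word n -> R -> R with
  | 0 => fun _ _ => 1
  | k.+1 => fun w x => F^`().[psi w.1 (point w.2 x)] * slope w.2 x
  end.

Lemma point_core n (w : word n) x : core x -> core (point w x).
Proof. by elim: n w => [|n ih] //= [i w] xc; apply: branch_core; rewrite //= ih. Qed.

Lemma horner_point n (w : word n.+1) x : core x -> F.[point w x] = point w.2 x.
Proof. by move=> xc; rewrite (branchP (ltn_ord _) (core_rho (point_core _ xc))).2. Qed.

Lemma iterp_point n (w : word n) x : core x -> (iterp n).[point w x] = x.
Proof.
elim: n w => [|n ih] w xc; first by rewrite hornerX.
by rewrite /iterp iterS horner_comp horner_point // ih.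
Qed.

Lemma slope_deriv n (w : word n) x : core x -> slope w x = (iterp n)^`().[point w x].
Proof.
elim: n w => [|n ih] w xc; first by rewrite derivX hornerC.
rewrite /iterp iterS deriv_comp hornerM horner_comp horner_point // -ih //.
by rewrite mulrC.
Qed.

Lemma point_inj n x : core x -> injective (fun w : word n => point w x).
Proof.
move=> xc; elim: n => [|n ih]; first by case=> -[].
move=> [i u] [j v] /= e.
have ij : i = j by apply: branch_inj e; apply/core_rho/point_core.
have uv : u = v.
  apply: ih; rewrite -(@horner_point n (i, u) x xc) -(@horner_point n (j, v) x xc) /=.
  by rewrite e.
by rewrite ij uv.
Qed.

(** A point between two preimages under the same word has each of its iterates
    between the corresponding preimages, by [band_monotone], so that
    [height_contraction] applies at every step. *)
Lemma cylinder n (w : word n) y z c : core y -> core z ->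
  (c - point w y) * (c - point w z) <= 0 ->
  [/\ core c, core (iterp n).[c] &
    h (iterp n).[c] <= (theta ^+ n) ^+ 2 * ((iterp n)^`().[c] ^+ 2 * h c)].
Proof.
move=> yc zc; elim: n w c => [|n ih] w c cb.
  rewrite hornerX derivX hornerC expr0 !expr1n !mul1r.
  suff: core c by [].
  move: yc zc cb => /=; rewrite !ler_norml => /andP[? ?] /andP[? ?] ?.
  by apply/andP; split; rewrite leNgt; apply/negP => ?; nra.
have pc u : core u -> core (point w.2 u) by exact: point_core.
have Fcb : (F.[c] - point w.2 y) * (F.[c] - point w.2 z) <= 0.
  have Fp u (uc : core u) := @horner_point n w u uc.
  move: cb; rewrite /=; case: (ltrgtP c (psi w.1 (point w.2 y))) => [c1|c1|->]; last first.
  - by move=> _; rewrite (Fp y yc) subrr mul0r.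
  - rewrite pmulr_rle0 ?subr_gt0 // subr_le0 le_eqVlt => /orP[/eqP->|c2].
      by rewrite (Fp z zc) subrr mulr0.
    by apply: (@band_monotone w.1) => //; [exact: pc|exact: pc|rewrite c1 c2].
  - rewrite nmulr_rle0 ?subr_lt0 // subr_ge0 le_eqVlt => /orP[/eqP<-|c2].
      by rewrite (Fp z zc) subrr mulr0.
    by rewrite mulrC; apply: (@band_monotone w.1) => //; [exact: pc|exact: pc|rewrite c1 c2].
have [Fc Tc hT] := ih w.2 _ Fcb; have cc := bands_inv H Fc.
rewrite /iterp iterS -/(iterp n) deriv_comp hornerM !horner_comp; split => //.
apply: (le_trans hT).
have cr : `|c - m| < r by apply: le_lt_trans cc (bands_r H).
have := height_contraction cr; move: theta => th hc; rewrite (exprS th n).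
have -> : (th * th ^+ n) ^+ 2 * (((iterp n)^`().[F.[c]] * F^`().[c]) ^+ 2 * h c) =
  (th ^+ n) ^+ 2 * ((iterp n)^`().[F.[c]] ^+ 2 *
     (th ^+ 2 * (F^`().[c] ^+ 2 * h c))) by ring.
by rewrite !ler_wpM2l ?sqr_ge0.
Qed.

Local Notation K0 := (r / Num.sqrt (r ^+ 2 - r0 ^+ 2)).

Let h0_gt0 : 0 < r ^+ 2 - r0 ^+ 2.
Proof. by have := bands_r0 H; have := bands_r H; nra. Qed.

Let theta_gt0 : 0 < theta. Proof. by rewrite divr_gt0 // mulr_gt0. Qed.

Lemma K0_gt0 : 0 < K0. Proof. by rewrite divr_gt0 // sqrtr_gt0. Qed.

(** On the core the height lies between r^2 - r0^2 > 0 and r^2, so its repeated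
    contraction becomes a lower bound for the derivative. *)
Lemma cylinder_deriv n (w : word n) y z c : core y -> core z ->
  (c - point w y) * (c - point w z) <= 0 ->
  1 <= K0 * theta ^+ n * `|(iterp n)^`().[c]|.
Proof.
move=> yc zc cb; have [cc Tc hT] := cylinder yc zc cb.
have r_ge0 := ltW r_gt0; have th_ge0 := ltW theta_gt0; have K_ge0 := ltW K0_gt0.
rewrite -(ler_pXn2r (n := 2)) ?nnegrE ?mulr_ge0 ?exprn_ge0 // expr1n.
have -> : (K0 * theta ^+ n * `|(iterp n)^`().[c]|) ^+ 2 =
    (theta ^+ n) ^+ 2 * ((iterp n)^`().[c] ^+ 2 * r ^+ 2) / (r ^+ 2 - r0 ^+ 2).
  rewrite (exprMn _ (K0 * _)) real_normK ?num_real // (exprMn _ K0) (exprMn _ r).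
  by rewrite exprVn sqr_sqrtr ?(ltW h0_gt0) //; ring.
rewrite ler_pdivlMr // mul1r.
have Th : (( iterp n).[c] - m) ^+ 2 <= r0 ^+ 2.
  by rewrite -real_normK ?num_real // ler_pXn2r ?nnegrE // (bands_r0 H).
apply: (@le_trans _ _ (h (iterp n).[c])); first by rewrite lerB.
apply: (le_trans hT); rewrite ler_wpM2l ?sqr_ge0 // ler_wpM2l ?sqr_ge0 //.
by rewrite lerBlDr lerDl sqr_ge0.
Qed.

Lemma slope_ge n (w : word n) x : core x -> 1 <= K0 * theta ^+ n * `|slope w x|.
Proof.
move=> xc; rewrite slope_deriv //; apply: (@cylinder_deriv _ w x x) => //.
by rewrite subrr mul0r.
Qed.

Lemma slope_neq0 n (w : word n) x : core x -> slope w x != 0.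
Proof.
move=> xc; apply: contraTneq (slope_ge w xc) => ->.
by rewrite normr0 mulr0 -ltNge ltr01.
Qed.

Lemma between_mid (a b c : R) : a <= c <= b -> (c - a) * (c - b) <= 0.
Proof. by move=> /andP[ac cb]; rewrite mulr_ge0_le0 // ?subr_ge0 ?subr_le0. Qed.

(** The mean value theorem for the n-th iterate, with [cylinder_deriv] at the
    intermediate point. *)
Lemma contraction n (w : word n) y z : core y -> core z ->
  `|point w y - point w z| <= K0 * theta ^+ n * `|y - z|.
Proof.
wlog yz : y z / point w y < point w z.
  move=> W yc zc; case: (ltgtP (point w y) (point w z)) => [e|e|->].
  - exact: W.
  - by rewrite distrC (distrC y); exact: W.
  - rewrite subrr normr0; apply: mulr_ge0 => //.
    exact: mulr_ge0 (ltW K0_gt0) (exprn_ge0 _ (ltW theta_gt0)).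
move=> yc zc; have [c] := poly_mvt (iterp n) yz.
rewrite in_itv /= => /andP[c1 c2]; rewrite !iterp_point // => e.
have := @cylinder_deriv n w y z c yc zc (between_mid _).
rewrite (ltW c1) (ltW c2) => /(_ isT) hc.
rewrite (distrC y) e normrM mulrA distrC ler_peMl //.
Qed.

(** The quotient is F' c / F' (psi k z) for a point c given by the mean value
    theorem, and F' is Lipschitz and bounded away from 0 on this part of the band. *)
Lemma branch_distortion : exists2 A, 0 <= A &
  forall (k : 'I_N) y z, core y -> core z -> y != z ->
  expR (- (A * `|psi k y - psi k z|)) <=
    (y - z) / ((psi k y - psi k z) * F^`().[psi k z]) <=
  expR (A * `|psi k y - psi k z|).
Proof.
have [kap kap0 hkap] := deriv_bands_ge.
have [L L1 hL] := poly_lipshitz F^`() (m - r0) (m + r0).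
have L0 : 0 <= L by exact: le_trans L1.
exists (L / kap) => [|k y z yc zc yz]; first by rewrite divr_ge0 // ltW.
set a := psi k y; set b := psi k z.
have Fa : F.[a] = y by exact: (branchP (ltn_ord k) (core_rho yc)).2.
have Fb : F.[b] = z by exact: (branchP (ltn_ord k) (core_rho zc)).2.
have ab : a != b by apply: contraNneq yz => ab; rewrite -Fa -Fb ab.
have mid x : (x - a) * (x - b) <= 0 -> core x /\ core F.[x].
  move=> hx; have := @cylinder 1 (k, tt) y z x yc zc hx.
  by rewrite /iterp /= horner_comp hornerX => -[].
have [c [c_ab ce]] : exists c, (c - a) * (c - b) <= 0 /\ y - z = F^`().[c] * (a - b).
  case: (ltgtP a b) ab => // lab _.
    have [c] := poly_mvt F lab; rewrite in_itv /= => /andP[c1 c2] e; exists c.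
    split; first by apply: between_mid; rewrite !ltW.
    by move: e; rewrite Fa Fb; lra.
  have [c] := poly_mvt F lab; rewrite in_itv /= => /andP[c1 c2] e; exists c.
  split; first by rewrite mulrC; apply: between_mid; rewrite !ltW.
  by move: e; rewrite Fa Fb.
have bb : (b - a) * (b - b) <= 0 by rewrite subrr mulr0.
have phi_bound u v : (u - a) * (u - b) <= 0 -> (v - a) * (v - b) <= 0 ->
    F^`().[u] / F^`().[v] <= expR (L / kap * `|a - b|).
  move=> hu hv; apply: le_trans (expR_ge1Dx _); rewrite addrC -lerBlDr.
  have [uc Fu] := mid _ hu; have [vc Fv] := mid _ hv.
  have hv' := hkap _ vc Fv.
  have v0 : F^`().[v] != 0 by rewrite -normr_gt0; exact: lt_le_trans hv'.
  apply: (le_trans (ler_norm _)).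
  have -> : F^`().[u] / F^`().[v] - 1 = (F^`().[u] - F^`().[v]) / F^`().[v] by field.
  rewrite normrM normfV ler_pdivrMr ?normr_gt0 //.
  have h1 : `|F^`().[u] - F^`().[v]| <= L * `|u - v|.
    by rewrite distrC (distrC u); apply: hL; rewrite in_itv /= -ler_distlC distrC.
  have h2 : `|u - v| <= `|a - b|.
    exact: between_dist.
  apply: (le_trans h1); apply: (@le_trans _ _ (L * `|a - b|)); first by rewrite ler_wpM2l.
  have -> : L * `|a - b| = L / kap * `|a - b| * kap by field; rewrite gt_eqF.
  by rewrite ler_wpM2l // !mulr_ge0 // invr_ge0 ltW.
have [bc Fbc] := mid _ bb; have [cc Fcc] := mid _ c_ab.
have b0 : F^`().[b] != 0 by rewrite -normr_gt0; exact: lt_le_trans (hkap _ bc Fbc).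
have c0 : F^`().[c] != 0 by rewrite -normr_gt0; exact: lt_le_trans (hkap _ cc Fcc).
have phiE : (y - z) / ((a - b) * F^`().[b]) = F^`().[c] / F^`().[b].
  by rewrite ce; field; rewrite b0 subr_eq0.
(* F' has no zero between a and b, where it is bounded away from 0. *)
have phi_gt0 : 0 < F^`().[c] / F^`().[b].
  have nz d : (d - a) * (d - b) <= 0 -> ~~ root F^`() d.
    move=> /mid[dc Fd]; rewrite rootE -normr_gt0; exact: lt_le_trans (hkap _ dc Fd).
  suff : 0 < F^`().[c] * F^`().[b].
    move=> hcb; have -> : F^`().[c] / F^`().[b] = F^`().[c] * F^`().[b] / F^`().[b] ^+ 2 by field.
    by rewrite divr_gt0 // exprn_even_gt0.
  rewrite ltNge; apply/negP => neg.
  case: (leP c b) => cb.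
    have [d] := polyrcf.poly_ivt cb neg; rewrite in_itv /= => /andP[d1 d2]; apply/negP/nz.
    move: cb; rewrite le_eqVlt => /orP[/eqP cb|cb].
      have -> : d = b by lra.
      by rewrite subrr mulr0.
    by move: c_ab; rewrite nmulr_lle0 ?subr_lt0 // => ?; rewrite mulr_ge0_le0 //; lra.
  have [d] : {d | d \in `[b, c] & root F^`() d}.
    by apply: polyrcf.poly_ivt; [exact: ltW|rewrite mulrC].
  rewrite in_itv /= => /andP[d1 d2]; apply/negP/nz.
  by move: c_ab; rewrite pmulr_lle0 ?subr_gt0 // => ?; rewrite mulr_le0_ge0 //; lra.
rewrite phiE phi_bound // andbT expRN -[leRHS]invrK lef_pV2 ?posrE ?expR_gt0 ?invr_gt0 //.
by rewrite invf_div phi_bound.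
Qed.

Lemma theta_lt1 : theta < 1.
Proof.
rewrite ltr_pdivrMr ?mulr_gt0 // mul1r (lt_le_trans (bands_rho H)) //.
by rewrite ler_peMr ?ler1n ?(bands_N H) // ltW.
Qed.

(** The quotient for a word is the product of the quotients of its letters, whose
    exponents decrease geometrically by [contraction]; hence a constant
    independent of the length. *)
Lemma distortion : exists2 B, 0 <= B &
  forall n (w : word n) y z, core y -> core z -> y != z ->
  expR (- (B * `|y - z|)) <=
    (y - z) / ((point w y - point w z) * slope w z) <= expR (B * `|y - z|).
Proof.
have [A A0 hA] := branch_distortion.
have th_ge0 := ltW theta_gt0; have K_ge0 := ltW K0_gt0.
(* the exponent accumulated over words of length n *)
pose E n := A * K0 * \sum_(i < n) theta ^+ i.+1.
exists (A * K0 * (1 - theta)^-1) => [|n w y z yc zc yz].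
  by apply: mulr_ge0; [exact: mulr_ge0|rewrite invr_ge0 subr_ge0 (ltW theta_lt1)].
have EB : E n <= A * K0 * (1 - theta)^-1.
  rewrite /E ler_wpM2l ?(mulr_ge0 A0 K_ge0) //.
  apply: le_trans (geometric_sum_le n th_ge0 theta_lt1); apply: ler_sum => i _.
  by rewrite exprS ler_piMl ?exprn_ge0 // (ltW theta_lt1).
suff /andP[h1 h2] : expR (- (E n * `|y - z|)) <=
    (y - z) / ((point w y - point w z) * slope w z) <= expR (E n * `|y - z|).
  apply/andP; split.
    by apply: le_trans h1; rewrite ler_expR lerN2 ler_wpM2r.
  by apply: (le_trans h2); rewrite ler_expR ler_wpM2r.
elim: n w {EB} => [|n ih] w.
  rewrite /E big_ord0 mulr0 mul0r oppr0 expR0 mulr1 divff ?lexx //.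
  by rewrite subr_eq0.
have := ih w.2; have := hA w.1 _ _ (point_core w.2 yc) (point_core w.2 zc).
set a' := point w.2 y; set b' := point w.2 z => hstep hrec.
have ab' : a' != b'.
  by apply: contraNneq yz => e; rewrite -(iterp_point w.2 yc) -/a' e iterp_point.
have /andP[s1 s2] := hstep ab'; have /andP[r1 r2] := hrec.
have Fp := @horner_point n w; rewrite -/a' -/b' in Fp.
have ab : psi w.1 a' != psi w.1 b'.
  by apply: contraNneq ab' => e; rewrite /a' /b' -!Fp //= -/a' -/b' e.
have s0 := slope_neq0 w.2 zc.
have F0 := slope_neq0 w zc; rewrite /= -/b' mulf_eq0 negb_or in F0.
have [F'0 _] := andP F0.
have -> : (y - z) / ((point w y - point w z) * slope w z) =
   (y - z) / ((a' - b') * slope w.2 z) *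
   ((a' - b') / ((psi w.1 a' - psi w.1 b') * F^`().[psi w.1 b'])).
  rewrite /= -/a' -/b'; field.
  by rewrite s0 F'0 !subr_eq0 ab ab'.
have step : A * `|psi w.1 a' - psi w.1 b'| <= A * K0 * theta ^+ n.+1 * `|y - z|.
  rewrite -!mulrA ler_wpM2l // !mulrA; exact: (@contraction n.+1 w).
have EE : E n.+1 * `|y - z| = E n * `|y - z| + A * K0 * theta ^+ n.+1 * `|y - z|.
  by rewrite /E big_ord_recr /= mulrDr mulrDl.
rewrite EE opprD !expRD; apply/andP; split.
  apply: ler_pM; rewrite ?expR_ge0 //; apply: le_trans s1.
  by rewrite ler_expR lerN2.
apply: ler_pM => //; [exact: le_trans (expR_ge0 _) r1|exact: le_trans (expR_ge0 _) s1|].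
by apply: (le_trans s2); rewrite ler_expR.
Qed.

(** An end of a band separates the two branch points, and its image is far from
    the core; [F] being Lipschitz, it is far from either point. *)
Lemma branch_separation : exists2 delta, 0 < delta &
  forall (i j : 'I_N) y z, i != j -> core y -> core z -> delta <= `|psi i y - psi j z|.
Proof.
have [M M1 hM] := poly_lipshitz F (m - r) (m + r).
have M0 : 0 < M by exact: lt_le_trans M1.
have r0rho : 0 < rho - r0 by have := bands_r H; have := bands_rho H; lra.
exists ((rho - r0) / M) => [|i j y z ij yc zc]; first exact: divr_gt0.
wlog ltij : i j y z ij yc zc / (i < j)%N => [W|].
  case: (ltngtP i j) => [e|e|/val_inj e]; first exact: W.
    by rewrite distrC; apply: W; rewrite // eq_sym.
  by rewrite e eqxx in ij.
have [/andP[i1 i2] Fi] := branchP (ltn_ord i) (core_rho yc).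
have [/andP[j1 j2] Fj] := branchP (ltn_ord j) (core_rho zc).
have sij := bands_le ltij (ltnW (ltn_ord j)).
have iN : (i.+1 <= N)%N by rewrite ltn_ord.
have := @hM (psi i y) (s i.+1); rewrite !in_itv /= -!ler_distlC.
have ir : `|m - psi i y| <= r.
  by rewrite distrC ltW // (band_sub (ltn_ord i)) // i1 i2.
have sr : `|m - s i.+1| <= r.
  have := bands_le (leq0n _) iN; have := bands_le iN (leqnn _).
  by rewrite ler_norml; have := bands_s0 H; have := bands_sN H; lra.
move=> /(_ ir sr); rewrite Fi => h1.
rewrite ler_pdivrMr // mulrC.
have h2 : rho - r0 <= `|F.[s i.+1] - y|.
  have := bands_big H iN; have := ler_normD (F.[s i.+1] - y) (y - m).
  have -> : F.[s i.+1] - y + (y - m) = F.[s i.+1] - m by ring.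
  by move: yc; lra.
apply: (le_trans h2); apply: (le_trans h1); rewrite ler_wpM2l ?(ltW M0) //.
rewrite gtr0_norm ?subr_gt0 // distrC ger0_norm; lra.
Qed.

End Bands.

(** * Interaction of two preimages *)

Section Depth.
Context {R : realType} (N : nat).

Lemma card_word n : #|word N n| = (N ^ n)%N.
Proof. by elim: n => [|n ih]; rewrite ?card_unit // card_prod card_ord ih expnS. Qed.

(** The cylinders of [u] and [v] interact with strength theta ^+ depth u v, see
    [kernel_bound]. *)
Fixpoint depth (n : nat) : word N n -> word N n -> nat :=
  match n return word N n -> word N n -> nat with
  | 0 => fun _ _ => 0%N
  | k.+1 => fun u v => if u.1 == v.1 then depth u.2 v.2 else k.+1
  end.

Lemma depthC n (u v : word N n) : depth u v = depth v u.
Proof. by elim: n u v => //= n ih u v; rewrite eq_sym ih. Qed.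

Lemma depthxx n (u : word N n) : depth u u = 0%N.
Proof. by elim: n u => //= n ih u; rewrite eqxx. Qed.

(** At most N^j words are at depth j from [u], so the sum is dominated by a
    geometric series of ratio N theta. *)
Lemma sum_depth_le (th : R) n (u : word N n) : 0 <= th -> N%:R * th < 1 ->
  \sum_(v : word N n) th ^+ depth u v <= (1 - N%:R * th)^-1.
Proof.
move=> th0 Nth; have q0 : 0 <= N%:R * th by rewrite mulr_ge0.
apply: le_trans (geometric_sum_le n.+1 q0 Nth).
elim: n u => [|n ih] u.
  rewrite big_ord_recr big_ord0 /= add0r !expr0 sumr_const.
  by rewrite (card_word 0).
rewrite big_ord_recr /= -(pair_big xpredT xpredT (fun i v => th ^+ depth u (i, v))) /=.
rewrite (bigD1 u.1) //= eqxx; apply: lerD; first exact: ih.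
apply: (@le_trans _ _ (\sum_(i : 'I_N) \sum_(v : word N n) th ^+ n.+1)).
  rewrite [leRHS](bigD1 u.1) //= ler_wpDl ?sumr_ge0 // => [v _|]; first exact: exprn_ge0.
  by apply: ler_sum => i /negPf iu; rewrite eq_sym iu.
by rewrite !sumr_const card_word card_ord -!mulrnA -expnSr -(mulr_natl (th ^+ _)) natrX exprMn.
Qed.

End Depth.

Section Kernel.
Context {R : realType} (F : {poly R}) (N : nat) (m r0 r rho : R) (s : nat -> R).
Context (H : expanding_bands F N m r0 r rho s).
Local Notation theta := (r / (rho * N%:R)).
Local Notation core y := (`|y - m| <= r0).
Local Notation K0 := (r / Num.sqrt (r ^+ 2 - r0 ^+ 2)).
Local Notation point := (point F s).
Local Notation slope := (slope F s).

Lemma split_words n (u v : word N n) : u != v ->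
  exists k (p : word N k) l (u' v' : word N l.+1),
  [/\ u'.1 != v'.1, depth u v = l.+1,
      forall x, point u x = point p (point u' x) /\
                slope u x = slope p (point u' x) * slope u' x &
      forall x, point v x = point p (point v' x) /\
                slope v x = slope p (point v' x) * slope v' x ].
Proof.
elim: n u v => [|n ih] u v uv; first by case: u v uv => -[].
have [uv1|uv1] := eqVneq u.1 v.1; last first.
  exists 0%N, tt, n, u, v; split => //= [|x|x]; first by rewrite (negPf uv1).
    by rewrite mul1r.
  by rewrite mul1r.
have uv2 : u.2 != v.2.
  by apply: contraNneq uv => uv2; rewrite [u]surjective_pairing uv1 uv2 -surjective_pairing.
have [k [p [l [u' [v' [h1 h2 h3 h4]]]]]] := ih _ _ uv2.
exists k.+1, (u.1, p), l, u', v'; split => // [|x|x] /=.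
- by rewrite uv1 eqxx.
- by have [-> ->] := h3 x; rewrite mulrA.
- by have [-> ->] := h4 x; rewrite uv1 mulrA.
Qed.

(** Let p be the common prefix of [u] and [v], and a, b the preimages under the
    remaining suffixes. Since a and b lie on different bands, |a - b| is bounded
    below, and by [distortion] the map of p scales it by 1 / |slope p a| up to a
    constant; the suffix of length j contributes a slope of order theta^-j. *)
Lemma kernel_bound : exists2 K, 0 <= K &
  forall n (u v : word N n) x y, u != v -> core x -> core y ->
  `|slope u x|^-1 <= K * theta ^+ depth u v * `|point u x - point v y| /\
  `|slope v y|^-1 <= K * theta ^+ depth u v * `|point u x - point v y|.
Proof.
have [B B0 hB] := distortion H; have [delta d0 hd] := branch_separation H.
have K0p := K0_gt0 H.
have r_gt0 : 0 < r by exact: le_lt_trans (bands_r0 H) (bands_r H).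
have th0 : 0 < theta.
  rewrite divr_gt0 // mulr_gt0 ?(lt_trans r_gt0 (bands_rho H)) //.
  by rewrite ltr0n (bands_N H).
pose E := expR (B * (2 * r0)).
(* The two inequalities are exchanged by swapping u and v. *)
have half k l (p : word N k) (w w' : word N l.+1) x y : core x -> core y ->
    w.1 != w'.1 ->
    `|slope p (point w x) * slope w x|^-1 <=
      E / delta * K0 * theta ^+ l.+1 * `|point p (point w x) - point p (point w' y)|.
  move=> xc yc ww'; set a := point w x; set b := point w' y.
  have ac : core a by exact: (point_core H).
  have bc : core b by exact: (point_core H).
  have ab : delta <= `|b - a|.
    by rewrite distrC; apply: hd => //; exact: (point_core H).
  have ba : b != a by apply: contraTneq ab => ->; rewrite subrr normr0 -ltNge.
  have /andP[g1 g2] := hB _ p b a bc ac ba.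
  have g_gt0 : 0 < (b - a) / ((point p b - point p a) * slope p a).
    exact: lt_le_trans (expR_gt0 _) g1.
  have sa : slope p a != 0 by exact: (slope_neq0 H).
  have pab : point p b - point p a != 0.
    by apply: contraTneq g_gt0 => ->; rewrite mul0r invr0 mulr0 ltxx.
  have gE : (b - a) / ((point p b - point p a) * slope p a) <= E.
    apply: (le_trans g2); rewrite ler_expR ler_wpM2l //.
    by rewrite -(subrK m b) -addrA (le_trans (ler_normD _ _)) // (distrC m); lra.
  have inv_a : `|slope p a|^-1 <= E / delta * `|point p a - point p b|.
    have -> : `|slope p a|^-1 =
        (b - a) / ((point p b - point p a) * slope p a) * `|point p a - point p b| / `|b - a|.
      rewrite -[X in _ = X * _ / _]gtr0_norm // !normrM normfV normrM (distrC (point p a)).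
      by field; rewrite !normr_eq0 sa pab subr_eq0 ba.
    rewrite -mulrA -[leRHS]mulrA [delta^-1 * _]mulrC; apply: ler_pM => //.
    - exact: ltW.
    - by rewrite ler_wpM2l // lef_pV2 ?posrE // (lt_le_trans d0).
  have inv_w : `|slope w x|^-1 <= K0 * theta ^+ l.+1.
    have sw : 0 < `|slope w x| by rewrite normr_gt0 (slope_neq0 H w xc).
    by rewrite -[X in X <= _]mul1r ler_pdivrMr // (slope_ge H w xc).
  rewrite normrM invfM.
  have -> : E / delta * K0 * theta ^+ l.+1 * `|point p a - point p b| =
    (E / delta * `|point p a - point p b|) * (K0 * theta ^+ l.+1) by ring.
  by apply: ler_pM; rewrite // invr_ge0.
exists (E / delta * K0); first exact: mulr_ge0 (divr_ge0 (expR_ge0 _) (ltW d0)) (ltW K0p).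
move=> n u v x y uv xc yc; have [k [p [l [u' [v' [h1 -> h3 h4]]]]]] := split_words uv.
have [-> ->] := h3 x; have [-> ->] := h4 y.
split; first exact: half.
by rewrite [`|_ - _|]distrC; apply: half; rewrite // eq_sym.
Qed.

End Kernel.

(** * Lagrange interpolation and Schur test *)

(** The nodes are the roots of T - y, whence the Lagrange basis polynomials are
    (T - y) / (T'(lam k) (X - lam k)). *)
Lemma lagrange_interpolation (K : fieldType) (I : finType) (lam : I -> K)
    (T Q : {poly K}) (y z : K) :
  size T = #|I|.+1 -> injective lam -> (forall k, T.[lam k] = y) ->
  (forall k, T^`().[lam k] != 0) -> (size Q <= #|I|)%N -> (forall k, z != lam k) ->
  Q.[z] = \sum_k Q.[lam k] * ((T.[z] - y) / (T^`().[lam k] * (z - lam k))).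
Proof.
move=> sT lam_inj Tlam T'lam sQ zlam.
have /choice[q qE] : forall k, exists q, T - y%:P = q * ('X - (lam k)%:P).
  by move=> k; apply/factor_theorem; rewrite rootE !hornerE Tlam subrr.
have q_diag k : (q k).[lam k] = T^`().[lam k].
  have := congr1 (fun p => p^`().[lam k]) (qE k).
  rewrite /= derivB derivC subr0 derivM derivXsubC mulr1 => ->.
  by rewrite !hornerE subrr mulr0 add0r.
have q_off k j : j != k -> (q k).[lam j] = 0.
  move=> jk; have := congr1 (fun p => p.[lam j]) (qE k).
  rewrite /= !hornerE Tlam subrr => /esym/eqP; rewrite mulf_eq0 subr_eq0 => /orP[/eqP//|].
  by rewrite (inj_eq lam_inj) (negPf jk).
have sTy : (0 < #|I|)%N -> size (T - y%:P) = #|I|.+1.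
  move=> h; rewrite size_polyDl // sT size_polyN.
  by rewrite (leq_ltn_trans (size_polyC_leq1 _)).
have sq k : (size (q k) <= #|I|)%N.
  have h : (0 < #|I|)%N by apply/card_gt0P; exists k.
  have := sTy h; rewrite (qE k) size_Mmonic ?monicXsubC //.
    by rewrite size_XsubC addn2 /= => -[->].
  by apply/eqP => q0; have := sTy h; rewrite (qE k) q0 mul0r size_poly0.
pose D := Q - \sum_k (Q.[lam k] / T^`().[lam k]) *: q k.
have D0 : D = 0.
  apply: (@roots_geq_poly_eq0 _ D [seq lam k | k <- enum I]).
  - apply/allP => _ /mapP[j _ ->]; rewrite rootE /D hornerD hornerN horner_sum.
    rewrite (bigD1 j) //= hornerZ q_diag divfK // big1 ?addr0 ?subrr // => k kj.
    by rewrite hornerZ q_off ?mulr0 // eq_sym.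
  - by rewrite map_inj_uniq // enum_uniq.
  - rewrite size_map -cardE /D (leq_trans (size_polyD _ _)) // geq_max sQ size_polyN.
    apply: (leq_trans (size_sum _ _ _)); apply/bigmax_leqP => k _.
    exact: leq_trans (size_scale_leq _ _) (sq k).
have QE : Q = \sum_k (Q.[lam k] / T^`().[lam k]) *: q k.
  by apply/eqP; rewrite -subr_eq0 -/D D0.
rewrite [in LHS]QE horner_sum; apply: eq_bigr => k _.
have hz : z - lam k != 0 by rewrite subr_eq0.
have -> : T.[z] - y = (q k).[z] * (z - lam k).
  by have := congr1 (fun p => p.[z]) (qE k); rewrite /= !hornerE.
by rewrite hornerZ; have := T'lam k; move: (T^`().[_]) (Q.[_]) => u v ?; field; rewrite hz.
Qed.

Section Modulus.
Context {R : realType}.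
Local Notation C := R[i].
Implicit Types (z : C) (a : R).

Lemma modulusM z z' : modulus (z * z') = modulus z * modulus z'.
Proof. exact: Normc.normcM. Qed.

Lemma modulus_ge0 z : 0 <= modulus z.
Proof. by case: z => a b; exact: sqrtr_ge0. Qed.

Lemma modulus_real a : modulus a%:C = `|a|.
Proof. by rewrite /modulus /= expr0n addr0 sqrtr_sqr. Qed.

Lemma modulusJ z : modulus z^*%C = modulus z.
Proof. by case: z => a b; rewrite /modulus /= sqrrN. Qed.

Lemma modulusN z : modulus (- z) = modulus z.
Proof. exact: normcN. Qed.

Lemma modulusD z z' : modulus (z + z') <= modulus z + modulus z'.
Proof. exact: le_normcD. Qed.

Lemma modulus0 : modulus (0 : C) = 0.
Proof. exact: Normc.normc0. Qed.

Lemma modulus_sum (I : finType) (P : pred I) (f : I -> C) :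
  modulus (\sum_(i | P i) f i) <= \sum_(i | P i) modulus (f i).
Proof.
elim/big_ind2: _ => [|x a y b xa yb|//]; first by rewrite modulus0.
exact: le_trans (modulusD _ _) (lerD xa yb).
Qed.

Lemma mulcJ z : z * z^*%C = (modulus z ^+ 2)%:C.
Proof.
case: z => a b; rewrite /modulus /= sqr_sqrtr ?addr_ge0 ?sqr_ge0 //.
by simpc; congr (_ +i* _); ring.
Qed.

Lemma conjc_scale a z : (a%:C * z)^*%C = a%:C * z^*%C.
Proof. by case: z => u v; simpc. Qed.

End Modulus.

(** Each product a b is at most (a^2 + b^2) / 2. *)
Lemma schur_test {R : realType} (I J : finType) (k : I -> J -> R) (S : R)
    (a : I -> R) (b : J -> R) :
  (forall i j, 0 <= k i j) ->
  (forall i, \sum_j k i j <= S) -> (forall j, \sum_i k i j <= S) ->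
  \sum_i a i ^+ 2 <= 1 -> \sum_j b j ^+ 2 <= 1 -> 0 <= S ->
  \sum_i \sum_j k i j * (a i * b j) <= S.
Proof.
move=> k0 rowS colS a1 b1 S0.
have -> : S = (S + S) / 2 by field.
apply: (@le_trans _ _ (\sum_i \sum_j k i j * ((a i ^+ 2 + b j ^+ 2) / 2))).
  apply: ler_sum => i _; apply: ler_sum => j _; rewrite ler_wpM2l //.
  by have := sqr_ge0 (a i - b j); nra.
have -> : \sum_i \sum_j k i j * ((a i ^+ 2 + b j ^+ 2) / 2) =
    (\sum_i a i ^+ 2 * \sum_j k i j + \sum_j b j ^+ 2 * \sum_i k i j) / 2.
  rewrite mulrDl 2!mulr_suml.
  under [X in _ = _ + X]eq_bigr => j _ do rewrite mulr_sumr mulr_suml.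
  rewrite [X in _ = _ + X]exchange_big /= -big_split /=; apply: eq_bigr => i _.
  rewrite mulr_sumr mulr_suml -big_split /=; by apply: eq_bigr => j _; field.
rewrite ler_wpM2r ?invr_ge0 //; apply: lerD.
  apply: (@le_trans _ _ (\sum_i a i ^+ 2 * S)).
    by apply: ler_sum => i _; rewrite ler_wpM2l ?sqr_ge0.
  by rewrite -mulr_suml ler_piMl.
apply: (@le_trans _ _ (\sum_j b j ^+ 2 * S)).
  by apply: ler_sum => i _; rewrite ler_wpM2l ?sqr_ge0.
by rewrite -mulr_suml ler_piMl.
Qed.

Section TwoMeasures.
Context {R : realType}.
Local Notation C := R[i].

Definition node_ip (I : finType) (lam w : I -> R) (p q : {poly C}) : C :=
  \sum_k (w k)%:C * (p.[(lam k)%:C] * (q.[(lam k)%:C])^*%C).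

(** Over a single point x of the base the factor T z - y becomes x - y; this
    factor is the source of the Lipschitz estimate. *)
Lemma interpolate_real_nodes (I : finType) (lam : I -> R) (T : {poly R}) (Q : {poly C})
    (x y z : R) :
  size T = #|I|.+1 -> injective lam -> (forall k, T.[lam k] = y) ->
  (forall k, T^`().[lam k] != 0) -> (size Q <= #|I|)%N -> T.[z] = x -> x != y ->
  Q.[z%:C] = \sum_k ((x - y) / (T^`().[lam k] * (z - lam k)))%:C * Q.[(lam k)%:C].
Proof.
move=> sT li Tl T'l sQ Tz xy.
rewrite (@lagrange_interpolation _ I (fun k => (lam k)%:C)
   (map_poly (real_complex R) T) Q y%:C) ?size_map_poly //.
- apply: eq_bigr => k _; rewrite mulrC; congr (_ * _).
  by rewrite deriv_map !horner_map /= Tz -!rmorphB -!rmorphM /= -fmorphV -rmorphM.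
- by move=> j k /complexI /li.
- by move=> k; rewrite horner_map Tl.
- by move=> k; rewrite deriv_map horner_map fmorph_eq0.
- by move=> k; apply/eqP => /complexI zl; move: xy; rewrite -Tz -(Tl k) zl eqxx.
Qed.

(** Interpolate Q from the nodes lam' in the first inner product and P from the
    nodes lam in the second. Both become bilinear forms in the values of Q at lam'
    and of P at lam, and Schur's test applies to the difference of their kernels.
    The difference has to be estimated as a whole: for two nearby nodes
    each kernel alone is close to 1. *)
Lemma compare_inner (I : finType) (lam lam' w w' : I -> R) (T : {poly R})
    (x y A S : R) (kap : I -> I -> R) (P Q : {poly C}) :
  size T = #|I|.+1 -> injective lam -> injective lam' ->
  (forall k, T.[lam k] = x) -> (forall k, T.[lam' k] = y) ->
  (forall k, T^`().[lam k] != 0) -> (forall k, T^`().[lam' k] != 0) -> x != y ->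
  (forall k, 0 < w k) -> (forall k, 0 < w' k) ->
  (forall k l,
     `|Num.sqrt (w k) / Num.sqrt (w' l) *
         ((x - y) / (T^`().[lam' l] * (lam k - lam' l)))
       - Num.sqrt (w' l) / Num.sqrt (w k) *
         ((y - x) / (T^`().[lam k] * (lam' l - lam k)))| <= A * kap k l) ->
  0 <= A -> 0 <= S -> (forall k l, 0 <= kap k l) ->
  (forall k, \sum_l kap k l <= S) -> (forall l, \sum_k kap k l <= S) ->
  (size P <= #|I|)%N -> (size Q <= #|I|)%N ->
  \sum_k w k * modulus P.[(lam k)%:C] ^+ 2 <= 1 ->
  \sum_k w' k * modulus Q.[(lam' k)%:C] ^+ 2 <= 1 ->
  modulus (node_ip lam w Q P - node_ip lam' w' Q P) <= A * S.
Proof.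
move=> sT li li' Tl Tl' T'l T'l' xy w0 w0' hker A0 S0 kap0 rowS colS sP sQ P1 Q1.
pose G k l := (x - y) / (T^`().[lam' l] * (lam k - lam' l)).
pose G' k l := (y - x) / (T^`().[lam k] * (lam' l - lam k)).
pose X k l := Q.[(lam' l)%:C] * (P.[(lam k)%:C])^*%C.
have yx : y != x by rewrite eq_sym.
have -> : node_ip lam w Q P - node_ip lam' w' Q P =
    \sum_k \sum_l (w k * G k l - w' l * G' k l)%:C * X k l.
  have -> : node_ip lam w Q P = \sum_k \sum_l (w k * G k l)%:C * X k l.
    apply: eq_bigr => k _.
    rewrite (interpolate_real_nodes sT li' Tl' T'l' sQ (Tl k) xy).
    rewrite mulr_suml mulr_sumr; apply: eq_bigr => l _.
    have -> : (w k * G k l)%:C = (w k)%:C * (G k l)%:C by rewrite rmorphM.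
    by rewrite /X -/(G k l); ring.
  have -> : node_ip lam' w' Q P = \sum_l \sum_k (w' l * G' k l)%:C * X k l.
    apply: eq_bigr => l _.
    rewrite (interpolate_real_nodes sT li Tl T'l sP (Tl' l) yx).
    rewrite rmorph_sum /= !mulr_sumr; apply: eq_bigr => k _.
    have -> : (w' l * G' k l)%:C = (w' l)%:C * (G' k l)%:C by rewrite rmorphM.
    by rewrite conjc_scale /X -/(G' k l); ring.
  rewrite [X in _ - X]exchange_big -sumrB; apply: eq_bigr => k _.
  rewrite -sumrB; apply: eq_bigr => l _.
  by rewrite -mulrBl -rmorphB.
have sw k : 0 < Num.sqrt (w k) by rewrite sqrtr_gt0.
have sw' k : 0 < Num.sqrt (w' k) by rewrite sqrtr_gt0.
pose a k := Num.sqrt (w k) * modulus P.[(lam k)%:C].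
pose b l := Num.sqrt (w' l) * modulus Q.[(lam' l)%:C].
apply: (@le_trans _ _ (\sum_k \sum_l (A * kap k l) * (a k * b l))).
  apply: (le_trans (modulus_sum _ _)); apply: ler_sum => k _.
  apply: (le_trans (modulus_sum _ _)); apply: ler_sum => l _.
  rewrite modulusM modulus_real /X modulusM modulusJ.
  have -> : w k * G k l - w' l * G' k l = Num.sqrt (w k) * Num.sqrt (w' l) *
      (Num.sqrt (w k) / Num.sqrt (w' l) * G k l - Num.sqrt (w' l) / Num.sqrt (w k) * G' k l).
    rewrite -{1}(sqr_sqrtr (ltW (w0 k))) -{1}(sqr_sqrtr (ltW (w0' l))).
    move: (sw k) (sw' l) (G k l) (G' k l); move: (Num.sqrt _) (Num.sqrt _) => u v u0 v0 g g'.
    by field; rewrite !gt_eqF.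
  rewrite normrM gtr0_norm ?mulr_gt0 // /a /b.
  have -> : A * kap k l * (Num.sqrt (w k) * modulus P.[(lam k)%:C] *
       (Num.sqrt (w' l) * modulus Q.[(lam' l)%:C])) =
     Num.sqrt (w k) * Num.sqrt (w' l) * (A * kap k l) *
       (modulus Q.[(lam' l)%:C] * modulus P.[(lam k)%:C]) by ring.
  by rewrite ler_wpM2r ?mulr_ge0 ?modulus_ge0 // ler_wpM2l ?hker ?mulr_ge0 ?sqrtr_ge0.
under eq_bigr do under eq_bigr do rewrite -mulrA.
under eq_bigr do rewrite -mulr_sumr.
rewrite -mulr_sumr ler_wpM2l //; apply: schur_test => //.
  rewrite (eq_bigr (fun k => w k * modulus P.[(lam k)%:C] ^+ 2)) // => k _.
  by rewrite /a exprMn sqr_sqrtr ?(ltW (w0 k)).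
rewrite (eq_bigr (fun k => w' k * modulus Q.[(lam' k)%:C] ^+ 2)) // => k _.
by rewrite /b exprMn sqr_sqrtr ?(ltW (w0' k)).
Qed.

End TwoMeasures.

(** * Orthonormal polynomials on finitely many real nodes *)

Lemma size_reduce (K : fieldType) (p e : {poly K}) n :
  (size p <= n.+1)%N -> (size e <= n.+1)%N -> e`_n != 0 ->
  (size (p - (p`_n / e`_n) *: e)%R <= n)%N.
Proof.
move=> sp se en; apply/leq_sizeP => j; rewrite leq_eqVlt => /orP[/eqP <-|nj].
  by rewrite coefB coefZ divfK // subrr.
rewrite coefB coefZ (nth_default _ (leq_trans sp nj)) (nth_default _ (leq_trans se nj)).
by rewrite mulr0 subr0.
Qed.

Section NodeInner.
Context {R : realType} (I : finType) (lam w : I -> R).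
Local Notation C := R[i].
Local Notation ip := (node_ip lam w).
Implicit Types p q : {poly C}.

Lemma node_ipDl p p' q : ip (p + p') q = ip p q + ip p' q.
Proof.
by rewrite /node_ip -big_split; apply: eq_bigr => k _; rewrite /= hornerD mulrDl mulrDr.
Qed.

Lemma node_ipZl c p q : ip (c *: p) q = c * ip p q.
Proof.
rewrite /node_ip mulr_sumr; apply: eq_bigr => k _.
by rewrite hornerZ -mulrA mulrCA.
Qed.

Lemma node_ipBl p p' q : ip (p - p') q = ip p q - ip p' q.
Proof. by rewrite -scaleN1r node_ipDl node_ipZl mulN1r. Qed.

Lemma node_ip_suml n (f : 'I_n -> {poly C}) q : ip (\sum_i f i) q = \sum_i ip (f i) q.
Proof.
elim/big_ind2: _ => [|x a y b <- <-|//]; last by rewrite node_ipDl.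
by rewrite -(scale0r 0) node_ipZl mul0r.
Qed.

Lemma node_ipJ p q : (ip p q)^*%C = ip q p.
Proof.
rewrite rmorph_sum /=; apply: eq_bigr => k _.
rewrite conjc_scale; congr (_ * _).
by case: (p.[_]) (q.[_]) => a b [c e]; simpc; congr (_ +i* _); ring.
Qed.

Lemma node_ip_mulX p q : ip ('X * p) q = ip p ('X * q).
Proof.
apply: eq_bigr => k _; rewrite !hornerM !hornerX conjc_scale; congr (_ * _).
by rewrite mulrAC mulrA mulrC mulrA mulrC.
Qed.

Lemma node_ip_norm p : ip p p = (\sum_k w k * modulus p.[(lam k)%:C] ^+ 2)%:C.
Proof.
by rewrite rmorph_sum; apply: eq_bigr => k _; rewrite mulcJ -rmorphM.
Qed.

Hypothesis w_gt0 : forall k, 0 < w k.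

(** The norm of the multiplication by the variable is the largest modulus of a node. *)
Lemma node_ip_bounded M p q : (forall k, `|lam k| <= M) -> ip p p = 1 -> ip q q = 1 ->
  modulus (ip ('X * p) q) <= M.
Proof.
move=> lamM pp qq.
have n1 r : ip r r = 1 -> \sum_k w k * modulus r.[(lam k)%:C] ^+ 2 = 1.
  by rewrite node_ip_norm => /complexI.
apply: (@le_trans _ _ (\sum_k (M / 2 * (w k * modulus p.[(lam k)%:C] ^+ 2)
    + M / 2 * (w k * modulus q.[(lam k)%:C] ^+ 2)))); last first.
  by rewrite big_split /= -!mulr_sumr !n1 // !mulr1 -splitr.
apply: (le_trans (modulus_sum _ _)); apply: ler_sum => k _.
rewrite !modulusM modulusJ modulus_real (gtr0_norm (w_gt0 k)) hornerM hornerX modulusM modulus_real.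
have := modulus_ge0 p.[(lam k)%:C]; have := modulus_ge0 q.[(lam k)%:C].
move: (modulus _) (modulus _) => a b a0 b0.
have M0 : 0 <= M by exact: le_trans (normr_ge0 _) (lamM k).
apply: (@le_trans _ _ (w k * (M * (b * a)))).
  by rewrite ler_wpM2l ?(ltW (w_gt0 k)) // -mulrA (mulrC a) ler_wpM2r ?mulr_ge0.
have -> : M / 2 * (w k * a ^+ 2) + M / 2 * (w k * b ^+ 2) =
  w k * (M * ((a ^+ 2 + b ^+ 2) / 2)) by field.
rewrite ler_wpM2l ?(ltW (w_gt0 k)) // ler_wpM2l //.
by have := sqr_ge0 (a - b); nra.
Qed.

Section Orthonormal.
Variables (d : nat) (P : 'I_d -> {poly C}).
Hypothesis sizeP : forall k, size (P k) = k.+1.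
Hypothesis leadP : forall k, 0 < lead_coef (P k).
Hypothesis orthoP : forall j k, ip (P j) (P k) = (j == k)%:R.

Definition top (k : 'I_d) : R := re (lead_coef (P k)).

Lemma top_gt0 k : 0 < top k.
Proof. by have := leadP k; rewrite /top; case: (lead_coef _) => a b; rewrite ltcE => /andP[]. Qed.

Lemma topE k : (P k)`_k = (top k)%:C.
Proof.
have := leadP k; rewrite /top lead_coefE sizeP /=.
by case: (_`_k) => a b; rewrite ltcE /= => /andP[/eqP -> _].
Qed.

Lemma topC_neq0 k : (top k)%:C != 0.
Proof. by rewrite fmorph_eq0 gt_eqF ?top_gt0. Qed.

Lemma node_ip_low p (j : 'I_d) : (size p <= j)%N -> ip p (P j) = 0.
Proof.
suff low n : (n <= j)%N -> forall p, (size p <= n)%N -> ip p (P j) = 0.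
  by move=> sp; exact: (low j).
elim: n => [|n ih] nj {}p sp.
  have -> : p = 0 *: 0 by rewrite scale0r; apply/eqP; rewrite -size_poly_leq0.
  by rewrite node_ipZl mul0r.
have nd : (n < d)%N by exact: ltn_trans nj (ltn_ord j).
pose k := Ordinal nd.
rewrite -[p](subrK ((p`_n / (P k)`_n) *: P k)) node_ipDl node_ipZl orthoP.
rewrite ih ?(ltnW nj) ?add0r //; last first.
  by apply: size_reduce; rewrite ?sizeP // (topE k) topC_neq0.
have -> : (k == j) = false by apply/negP => /eqP kj; rewrite -kj ltnn in nj.
by rewrite mulr0.
Qed.

(** [p] differs from a multiple of [P j] by a polynomial of smaller degree. *)
Lemma node_ip_top p (j : 'I_d) : (size p <= j.+1)%N -> ip p (P j) = p`_j / (top j)%:C.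
Proof.
move=> sp; rewrite -[in LHS](subrK ((p`_j / (P j)`_j) *: P j) p) node_ipDl node_ipZl orthoP.
by rewrite node_ip_low ?add0r ?eqxx ?mulr1 ?topE // -topE size_reduce ?sizeP // topE topC_neq0.
Qed.

Lemma jacobi_far (i j : 'I_d) : (j.+1 < i)%N -> ip ('X * P j) (P i) = 0.
Proof.
move=> ji; apply: node_ip_low; rewrite mulrC size_mulX ?sizeP //.
by rewrite -size_poly_eq0 sizeP.
Qed.

Lemma jacobi_sub (i j : 'I_d) : i = j.+1 :> nat ->
  ip ('X * P j) (P i) = (top j / top i)%:C.
Proof.
move=> ij; rewrite node_ip_top; last first.
  by rewrite mulrC size_mulX ?sizeP ?ij // -size_poly_eq0 sizeP.
by rewrite coefXM ij /= topE rmorphM /= fmorphV.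
Qed.

(** The diagonal entry is determined by the two highest coefficients of [P j] and
    those of any [e] of degree j + 1 orthogonal to [P j]. Such an [e] is the next
    orthonormal polynomial or, in the last row, the polynomial that vanishes at
    all nodes. *)
Lemma jacobi_diag (j : 'I_d) (e : {poly C}) : (size e <= j.+2)%N -> e`_j.+1 != 0 ->
  ip e (P j) = 0 ->
  ip ('X * P j) (P j) = ('X * P j)`_j / (top j)%:C - e`_j / e`_j.+1.
Proof.
move=> se e0 ie.
have sX : (size ('X * P j)%R <= j.+2)%N.
  by rewrite mulrC size_mulX ?sizeP // -size_poly_eq0 sizeP.
have := node_ip_top (size_reduce sX se e0).
rewrite node_ipBl node_ipZl ie mulr0 subr0 => ->.
have Xj : ('X * P j)`_j.+1 = (top j)%:C by rewrite coefXM /= topE.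
rewrite coefB coefZ Xj; have := topC_neq0 j.
by move: (top j)%:C (_`_j) e0 => t u e0 t0; field; rewrite e0.
Qed.

End Orthonormal.

(** Gram-Schmidt applied to the powers of the variable. The residual has degree
    less than the number of nodes, so it cannot vanish at all of them and its norm
    is positive. *)
Lemma exists_orthonormal : injective lam ->
  exists P : 'I_#|I| -> {poly C}, [/\ forall k, size (P k) = k.+1,
     forall k, 0 < lead_coef (P k) & forall j k, ip (P j) (P k) = (j == k)%:R].
Proof.
move=> lam_inj.
suff step n : (n <= #|I|)%N -> exists P : nat -> {poly C}, [/\
    forall k, (k < n)%N -> size (P k) = k.+1,
    forall k, (k < n)%N -> 0 < lead_coef (P k) &
    forall j k, (j < n)%N -> (k < n)%N -> ip (P j) (P k) = (j == k)%:R].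
  have [P [h1 h2 h3]] := step _ (leqnn _).
  exists (fun k : 'I_#|I| => P k); split => [k|k|j k]; [exact: h1|exact: h2|].
  by rewrite h3.
elim: n => [|n ih] nI; first by exists (fun=> 0).
have [P [h1 h2 h3]] := ih (ltnW nI).
pose q := 'X^n - \sum_(i < n) ip 'X^n (P i) *: P i.
have s_low : (size (\sum_(i < n) ip 'X^n (P i) *: P i)%R <= n)%N.
  apply: (leq_trans (size_sum _ _ _)); apply/bigmax_leqP => i _.
  by rewrite (leq_trans (size_scale_leq _ _)) // h1.
have sq : size q = n.+1 by rewrite size_polyDl ?size_polyXn // size_polyN.
have lq : lead_coef q = 1.
  by rewrite lead_coefDl ?lead_coefXn // size_polyN size_polyXn.
have q_ortho j : (j < n)%N -> ip q (P j) = 0.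
  move=> jn; rewrite /q node_ipBl node_ip_suml (bigD1 (Ordinal jn)) //=.
  rewrite node_ipZl h3 // eqxx mulr1 big1 ?addr0 ?subrr // => k kj.
  rewrite node_ipZl h3 //; suff -> : (k == j :> nat) = false by rewrite mulr0.
  by apply/negP => /eqP kj'; move/eqP: kj; apply; exact/val_inj.
pose N2 := \sum_k w k * modulus q.[(lam k)%:C] ^+ 2.
have N2_gt0 : 0 < N2.
  have [k qk] : exists k, q.[(lam k)%:C] != 0.
    apply: contrapT => all0.
    have : (size [seq (lam k)%:C | k <- enum I] < size q)%N.
      apply: max_poly_roots; first by rewrite -size_poly_eq0 sq.
        apply/allP => _ /mapP[k _ ->]; rewrite rootE; apply/negPn/negP => qk.
        by apply: all0; exists k.
      by rewrite map_inj_uniq ?enum_uniq // => a b /complexI /lam_inj.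
    by rewrite size_map -cardE sq ltnS leqNgt nI.
  rewrite /N2 (bigD1 k) //= ltr_wpDr //.
    by apply: sumr_ge0 => j _; rewrite mulr_ge0 ?sqr_ge0 // ltW.
  rewrite mulr_gt0 // exprn_even_gt0 //=; apply: contra_neq qk => /eqP.
  by move=> /eqP/Normc.eq0_normc.
pose c := (Num.sqrt N2)^-1.
have c_gt0 : 0 < c by rewrite invr_gt0 sqrtr_gt0.
exists (fun k => if k == n then c%:C *: q else P k).
have ltn_neq k : (k < n.+1)%N -> k != n -> (k < n)%N by rewrite ltnS ltn_neqAle => -> ->.
have cC : c%:C != 0 :> C by rewrite fmorph_eq0 gt_eqF.
split=> [k kn|k kn|j k jn kn].
- case: eqP => [->|/eqP nk]; first by rewrite size_scale.
  exact/h1/ltn_neq.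
- case: eqP => [_|/eqP nk]; first by rewrite lead_coefZ lq mulr1 ltcR.
  exact/h2/ltn_neq.
- have ipcC p p' : ip p (c%:C *: p') = c%:C * ip p p'.
    by rewrite -node_ipJ node_ipZl conjc_scale node_ipJ.
  have [jn'|jn'] := eqVneq j n; have [kn'|kn'] := eqVneq k n.
  + rewrite jn' kn' eqxx node_ipZl ipcC node_ip_norm -/N2 -!rmorphM /= mulrA -expr2.
    by rewrite exprVn sqr_sqrtr ?(ltW N2_gt0) // mulVf ?gt_eqF.
  + by rewrite node_ipZl q_ortho ?ltn_neq // mulr0 jn' eq_sym (negPf kn').
  + by rewrite ipcC -node_ipJ q_ortho ?ltn_neq // conjc0 mulr0 kn' (negPf jn').
  + by rewrite h3 // ltn_neq.
Qed.

End NodeInner.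

(** * Perturbation of Jacobi matrices *)

Lemma real_complex_div {R : rcfType} (a b : R) : (a / b)%:C = a%:C / b%:C.
Proof. by rewrite rmorphM fmorphV. Qed.

Lemma norm_re_le {R : realType} (z : R[i]) : `|re z| <= modulus z.
Proof.
by case: z => a b; rewrite /modulus /= -sqrtr_sqr ler_wsqrtr // lerDl sqr_ge0.
Qed.

Section JacobiComparison.
Context {R : realType} (I : finType) (lam w lam' w' : I -> R) (d : nat).
Local Notation C := R[i].
Context (P Q : 'I_d -> {poly C}) (T : {poly R}) (x y M eta : R).
Local Notation ip := (node_ip lam w).
Local Notation ip' := (node_ip lam' w').
Hypotheses (d_ge2 : (2 <= d)%N)
  (w_gt0 : forall k, 0 < w k)
  (sizeP : forall k, size (P k) = k.+1)
  (leadP : forall k, 0 < lead_coef (P k))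
  (orthoP : forall j k, ip (P j) (P k) = (j == k)%:R)
  (sizeQ : forall k, size (Q k) = k.+1)
  (leadQ : forall k, 0 < lead_coef (Q k))
  (orthoQ : forall j k, ip' (Q j) (Q k) = (j == k)%:R)
  (lamM : forall k, `|lam k| <= M)
  (sizeT : size T = d.+1)
  (Tlam : forall k, T.[lam k] = x) (Tlam' : forall k, T.[lam' k] = y)
  (eta0 : 0 <= eta)
  (close : forall i j, modulus (ip (Q i) (P j) - ip' (Q i) (P j)) <= eta).

Local Notation p := (top P).
Local Notation q := (top Q).
Let p_gt0 k : 0 < p k. Proof. exact: top_gt0. Qed.
Let q_gt0 k : 0 < q k. Proof. exact: top_gt0. Qed.

(** The inner product of [Q j] and [P j] is q j / p j for the first measure and
    p j / q j for the second; a positive number close to its inverse is close to 1. *)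
Lemma top_ratio_close j : `|q j / p j - 1| <= eta /\ `|p j / q j - 1| <= eta.
Proof.
have : `|q j / p j - p j / q j| <= eta.
  have -> : q j / p j - p j / q j = re (ip (Q j) (P j) - ip' (Q j) (P j)).
    rewrite (node_ip_top sizeP leadP orthoP) ?sizeQ // (topE sizeQ leadQ).
    rewrite -(node_ipJ lam' w') (node_ip_top sizeQ leadQ orthoQ) ?sizeP // (topE sizeP leadP).
    by rewrite -!real_complex_div conjc_real.
  exact: le_trans (norm_re_le _) (close j j).
have e : p j / q j = (q j / p j)^-1 by rewrite invf_div.
rewrite e; have := divr_gt0 (q_gt0 j) (p_gt0 j); move: (q j / p j) => l l0.
have l1 : l * l^-1 = 1 by rewrite divff // gt_eqF.
have l0' : 0 < l^-1 by rewrite invr_gt0.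
move: l^-1 l1 l0' => l' l1 l0'.
by rewrite !ler_norml => /andP[? ?]; split; apply/andP; split; nra.
Qed.

Lemma top_ratio_le (i j : 'I_d) : i = j.+1 :> nat -> p j / p i <= M.
Proof.
move=> ij; have h := jacobi_sub sizeP leadP orthoP ij.
have P1 k : ip (P k) (P k) = 1 by rewrite orthoP eqxx.
have := node_ip_bounded w_gt0 lamM (P1 j) (P1 i); rewrite h modulus_real.
exact: le_trans (ler_norm _).
Qed.

Let M_ge0 : 0 <= M.
Proof.
have h : (1 < d)%N by [].
apply: le_trans (@top_ratio_le (Ordinal h) (Ordinal (ltnW h)) erefl).
by rewrite divr_ge0 // ltW.
Qed.

Local Notation bound := (M * (1 + eta) * eta).

(** The difference is the inner product of [Q i] and [P j] for the first measure,
    up to the factor p j / q i, and this inner product vanishes for the second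
    measure by orthogonality. *)
Lemma second_coef_close (i j : 'I_d) : i = j.+1 :> nat ->
  modulus ((Q i)`_j / (q i)%:C - (P i)`_j / (p i)%:C) <= bound.
Proof.
move=> ij; have eP := topC_neq0 leadP.
have eQ := topC_neq0 leadQ.
have sub : (Q i)`_j / (q i)%:C - (P i)`_j / (p i)%:C = ip (Q i) (P j) * (p j / q i)%:C.
  have sPi : (size (P i) <= j.+2)%N by rewrite sizeP ij.
  have sQi : (size (Q i) <= j.+2)%N by rewrite sizeQ ij.
  have Pij : (P i)`_j.+1 = (p i)%:C by rewrite -ij (topE sizeP leadP).
  have Qij : (Q i)`_j.+1 = (q i)%:C by rewrite -ij (topE sizeQ leadQ).
  have P0 : (P i)`_j.+1 != 0 by rewrite Pij.
  have := node_ip_top sizeP leadP orthoP (size_reduce sQi sPi P0).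
  rewrite node_ipBl node_ipZl orthoP.
  have -> : (i == j) = false by apply/eqP => e; move: ij; rewrite e => /n_Sn.
  rewrite mulr0 subr0 => ->; rewrite coefB coefZ Pij Qij real_complex_div.
  move: (eP i) (eP j) (eQ i); move: (p i)%:C (p j)%:C (q i)%:C (_`_j) (_`_j).
  by move=> u v t g g' ? ? ?; field; apply/and3P.
have L_le : modulus (ip (Q i) (P j)) <= eta.
  have := close i j; rewrite -(node_ipJ lam' w' (P j)).
  by rewrite (node_ip_low sizeQ leadQ orthoQ) ?sizeP ?ij // conjc0 subr0.
have pq : p j / q i <= M * (1 + eta).
  have -> : p j / q i = p j / p i * (p i / q i) by field; rewrite !gt_eqF ?p_gt0 ?q_gt0.
  apply: ler_pM; rewrite ?divr_ge0 ?(ltW (p_gt0 _)) ?(ltW (q_gt0 _)) ?top_ratio_le //.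
  by have [_] := top_ratio_close i; rewrite ler_norml; lra.
rewrite sub modulusM modulus_real gtr0_norm ?divr_gt0 // mulrC.
by apply: ler_pM; rewrite ?divr_ge0 ?modulus_ge0 ?(ltW (p_gt0 _)) ?(ltW (q_gt0 _)).
Qed.

Let bound_ge0 : 0 <= bound. Proof. by rewrite !mulr_ge0 // addr_ge0. Qed.

Lemma jacobi_diag_close j :
  modulus (ip ('X * P j) (P j) - ip' ('X * Q j) (Q j)) <= 2 * bound.
Proof.
(* polynomials to which [jacobi_diag] applies: the next orthonormal ones or, in
   the last row, T - x and T - y, which have the same coefficients of degree > 0 *)
have [eP [eQ [[sP sQ] [P0 Q0] [zP zQ] eclose]]] : exists eP eQ : {poly C},
   [/\ (size eP <= j.+2)%N /\ (size eQ <= j.+2)%N, eP`_j.+1 != 0 /\ eQ`_j.+1 != 0,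
     ip eP (P j) = 0 /\ ip' eQ (Q j) = 0 &
     modulus (eQ`_j / eQ`_j.+1 - eP`_j / eP`_j.+1) <= bound].
  have [jd|jd] := boolP (j.+1 < d)%N.
    pose i := Ordinal jd; exists (P i), (Q i); rewrite !sizeP !sizeQ.
    rewrite (topE sizeP leadP i) (topE sizeQ leadQ i) (topC_neq0 leadP) (topC_neq0 leadQ).
    rewrite orthoP orthoQ.
    have -> : (i == j) = false by apply/eqP => /(congr1 val) /= /esym /n_Sn.
    by split => //; exact: second_coef_close.
  have {}jd : d = j.+1 by apply/eqP; rewrite eqn_leq ltn_ord andbT leqNgt.
  have j0 : (0 < j)%N by rewrite -ltnS -jd.
  have sT : size T = j.+2 by rewrite sizeT -jd.
  pose TC := map_poly (real_complex R) T.
  have e_coef (v : R) n : (0 < n)%N -> (TC - v%:C%:P)`_n = (T`_n)%:C.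
    by move=> n0; rewrite coefB coefC gtn_eqF // subr0 coef_map.
  have e_size (v : R) : (size (TC - v%:C%:P)%R <= j.+2)%N.
    rewrite (leq_trans (size_polyD _ _)) // geq_max size_polyN size_map_poly sT leqnn.
    by rewrite (leq_trans (size_polyC_leq1 _)).
  have e_ip (mu nu : I -> R) v r : (forall k, T.[mu k] = v) -> node_ip mu nu (TC - v%:C%:P) r = 0.
    move=> Tv; apply: big1 => k _.
    rewrite (_ : (TC - v%:C%:P).[(mu k)%:C] = 0) ?mul0r ?mulr0 //.
    by rewrite hornerD hornerN hornerC horner_map Tv; exact: subrr.
  have lT : (T`_j.+1)%:C != 0 :> C.
    rewrite fmorph_eq0 (_ : T`_j.+1 = lead_coef T) ?lead_coefE ?sT //.
    by rewrite -[_ == 0]/(_ == 0) -[j.+1]/(j.+2.-1) -sT -lead_coefE lead_coef_eq0 -size_poly_eq0 sT.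
  exists (TC - x%:C%:P), (TC - y%:C%:P).
  rewrite !e_coef // !e_size !e_ip //; split => //.
  by rewrite subrr modulus0.
rewrite (jacobi_diag sizeP leadP orthoP sP P0 zP) (jacobi_diag sizeQ leadQ orthoQ sQ Q0 zQ).
have c_close : modulus (('X * Q j)`_j / (q j)%:C - ('X * P j)`_j / (p j)%:C) <= bound.
  rewrite !coefXM; case: eqP => [j0|]; first by rewrite !mul0r subr0 modulus0.
  move=> /eqP; rewrite -lt0n => j0.
  have jd : (j.-1 < d)%N by rewrite (leq_ltn_trans (leq_pred _)).
  by apply: (@second_coef_close j (Ordinal jd)); rewrite /= prednK.
have -> : forall u v u' v' : C, u - v - (u' - v') = - (u' - u) + (v' - v) by move=> *; ring.
rewrite (le_trans (modulusD _ _)) // modulusN mulr2n mulrDl mul1r.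
exact: lerD.
Qed.

Lemma jacobi_sub_close (i j : 'I_d) : i = j.+1 :> nat ->
  modulus (ip ('X * P j) (P i) - ip' ('X * Q j) (Q i)) <= 2 * bound.
Proof.
move=> ij; rewrite (jacobi_sub sizeP leadP orthoP ij) (jacobi_sub sizeQ leadQ orthoQ ij).
rewrite -rmorphB modulus_real /=.
have -> : p j / p i - q j / q i =
  p j / p i * (((q i / p i - 1) - (q j / p j - 1)) * (p i / q i)).
  by field; rewrite !gt_eqF ?p_gt0 ?q_gt0.
rewrite !normrM; have [h1 h1'] := top_ratio_close i; have [h2 _] := top_ratio_close j.
have -> : 2 * bound = M * ((eta + eta) * (1 + eta)) by ring.
apply: ler_pM => //; first by rewrite -normrM gtr0_norm ?divr_gt0 // top_ratio_le.
rewrite -normrM; apply: ler_pM => //.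
  by rewrite (le_trans (ler_normB _ _)) // lerD.
by rewrite gtr0_norm ?divr_gt0 //; move: h1'; rewrite ler_norml; lra.
Qed.

Lemma jacobi_close (i j : 'I_d) :
  modulus (ip ('X * P j) (P i) - ip' ('X * Q j) (Q i)) <= 2 * bound.
Proof.
wlog ji : i j / (j <= i)%N => [W|].
  have [|/ltnW] := leqP j i; first exact: W.
  move=> /W; rewrite -(node_ipJ lam w) -(node_ipJ lam' w') -rmorphB modulusJ.
  by rewrite -!node_ip_mulX.
case: (ltngtP i j.+1) => [ij|ij|]; last exact: jacobi_sub_close.
  have -> : i = j by apply/val_inj/eqP; rewrite eqn_leq ji andbT -ltnS.
  exact: jacobi_diag_close.
rewrite (jacobi_far sizeP leadP orthoP ij) (jacobi_far sizeQ leadQ orthoQ ij) subr0 modulus0.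
by rewrite mulr_ge0.
Qed.

Lemma jacobi_close_far (i j : 'I_d) : (j.+1 < i)%N || (i.+1 < j)%N ->
  ip ('X * P j) (P i) - ip' ('X * Q j) (Q i) = 0.
Proof.
case/orP => ij.
  by rewrite (jacobi_far sizeP leadP orthoP ij) (jacobi_far sizeQ leadQ orthoQ ij) subr0.
rewrite -(node_ipJ lam w) -(node_ipJ lam' w') -!node_ip_mulX.
by rewrite (jacobi_far sizeP leadP orthoP ij) (jacobi_far sizeQ leadQ orthoQ ij) conjc0 subr0.
Qed.

End JacobiComparison.

Lemma sum_indicator_le1 {R : numDomainType} d n : \sum_(j < d) (j == n :> nat)%:R <= 1 :> R.
Proof.
have [nd|nd] := boolP (n < d)%N.
  rewrite (bigD1 (Ordinal nd)) //= eqxx big1 ?addr0 // => j /negPf jn.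
  suff -> : (j == n :> nat) = false by [].
  by apply/negP => /eqP jn'; move/eqP: jn; apply; exact/val_inj.
rewrite big1 ?ler01 // => j _.
by rewrite ltn_eqF // (leq_trans (ltn_ord j)) // leqNgt.
Qed.

(** Schur's test for a 0-1 kernel with at most three ones in each row and column. *)
Lemma operator_norm_tridiag {R : realType} d (A : 'M[R[i]]_d) (eps : R) : 0 <= eps ->
  (forall i j, modulus (A i j) <= eps) ->
  (forall i j : 'I_d, (j.+1 < i)%N || (i.+1 < j)%N -> A i j = 0) ->
  operator_norm A <= 3 * eps.
Proof.
move=> eps0 Aeps Afar.
(* the indicator of the three diagonals *)
pose k (i j : 'I_d) : R := (j.+1 == i)%:R + (j == i :> nat)%:R + (i.+1 == j)%:R.
have k_ge0 i j : 0 <= k i j by rewrite !addr_ge0.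
have three : 3 = 1 + 1 + 1 :> R by ring.
have rows i : \sum_j k i j <= 3.
  rewrite /k !big_split /= three !lerD //.
  - apply: le_trans (sum_indicator_le1 d i.-1); apply: ler_sum => j _.
    by case: eqP => [<-|_] //=; rewrite eqxx.
  - exact: sum_indicator_le1.
  - apply: le_trans (sum_indicator_le1 d i.+1); apply: ler_sum => j _.
    by rewrite eq_sym.
have kC i j : k i j = k j i by rewrite /k (eq_sym (j : nat) i); ring.
have Ak i j : modulus (A i j) <= eps * k i j.
  have [far|near] := boolP ((j.+1 < i)%N || (i.+1 < j)%N).
    by rewrite Afar // modulus0 mulr_ge0.
  apply: (le_trans (Aeps i j)); rewrite ler_peMr // /k.
  have n0 (b : bool) : 0 <= b%:R :> R by [].
  have : [|| j.+1 == i, j == i :> nat | i.+1 == j] by move: near; lia.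
  by case/or3P => ->; [have := n0 (j == i :> nat); have := n0 (i.+1 == j)
    |have := n0 (j.+1 == i); have := n0 (i.+1 == j)
    |have := n0 (j.+1 == i); have := n0 (j == i :> nat)]; rewrite /=; lra.
apply: ge_sup => [|_ [v /= v1 <-]].
  exists (euclidean_norm (A *m 0)), 0 => //=.
  rewrite /euclidean_norm big1 ?sqrtr0 // => i _.
  by rewrite mxE modulus0 expr0n.
rewrite /euclidean_norm; set b := fun i => modulus ((A *m v) i 0).
set B := Num.sqrt _; have [B0|B0] := eqVneq B 0; first by rewrite B0 mulr_ge0.
have B_gt0 : 0 < B by rewrite lt_def B0 sqrtr_ge0.
have BE : \sum_i b i ^+ 2 = B ^+ 2.
  by rewrite sqr_sqrtr // sumr_ge0 // => i _; exact: sqr_ge0.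
have -> : B = \sum_i b i / B * b i.
  apply: (mulIf B0); rewrite -expr2 -BE mulr_suml; apply: eq_bigr => i _.
  by field.
apply: (@le_trans _ _ (\sum_i \sum_j eps * (k i j * (b i / B * modulus (v j 0))))).
  apply: ler_sum => i _.
  have -> : \sum_j eps * (k i j * (b i / B * modulus (v j 0))) =
      b i / B * \sum_j eps * k i j * modulus (v j 0).
    by rewrite mulr_sumr; apply: eq_bigr => j _; ring.
  rewrite ler_wpM2l ?divr_ge0 ?modulus_ge0 ?sqrtr_ge0 // /b mxE.
  apply: (le_trans (modulus_sum _ _)); apply: ler_sum => j _.
  by rewrite modulusM ler_wpM2r ?modulus_ge0.
under eq_bigr do rewrite -mulr_sumr.
rewrite -mulr_sumr mulrC ler_wpM2r //; apply: schur_test => //.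
- by move=> j; under eq_bigr do rewrite kC.
- under eq_bigr do rewrite exprMn.
  by rewrite -mulr_suml BE exprVn divff // expf_neq0.
- move: v1; rewrite /euclidean_norm -[in X in _ <= X -> _](sqrtr1 R) ler_sqrt //.
Qed.

(** * Bands of a real-rooted hyperbolic polynomial *)

Section RealRooted.
Context {R : realType}.

Definition laguerre (p : {poly R}) (c : R) : R :=
  p^`().[c] ^+ 2 - p.[c] * p^`()^`().[c].

Lemma laguerre_mul (q : {poly R}) (z c : R) :
  laguerre (('X - z%:P) * q) c = q.[c] ^+ 2 + (c - z) ^+ 2 * laguerre q c.
Proof.
rewrite /laguerre !(derivM, derivXsubC, derivD, mul1r).
rewrite !(hornerXsubC, hornerD, hornerM).
by move: q.[c] q^`().[c] q^`()^`().[c] => x y w; ring.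
Qed.

Lemma laguerre_ge0 (alpha : R) (rs : seq R) (c : R) :
  0 <= laguerre (alpha *: \prod_(z <- rs) ('X - z%:P)) c.
Proof.
elim: rs => [|z rs ih].
  by rewrite /laguerre big_nil derivZ derivC scaler0 deriv0 !horner0 mulr0 subr0 expr0n.
by rewrite big_cons scalerAr laguerre_mul addr_ge0 ?sqr_ge0 // mulr_ge0 ?sqr_ge0.
Qed.

(** Laguerre's inequality p'^2 - p p'' > 0 for real-rooted p away from its roots, by
    induction on the roots. *)
Lemma laguerre_gt0 (alpha : R) (rs : seq R) (c : R) : rs != [::] ->
  (alpha *: \prod_(z <- rs) ('X - z%:P)).[c] != 0 ->
  0 < laguerre (alpha *: \prod_(z <- rs) ('X - z%:P)) c.
Proof.
case: rs => // z rs _; rewrite big_cons scalerAr hornerM mulf_eq0 negb_or => /andP[_ q0].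
rewrite laguerre_mul ltr_pwDl //; last by rewrite mulr_ge0 ?sqr_ge0 ?laguerre_ge0.
by rewrite exprn_even_gt0.
Qed.

Lemma prod_sign (f : R -> R) (rs : seq R) (sg : R) : sg * sg = 1 ->
  \prod_(z <- rs) f z = sg ^+ size rs * \prod_(z <- rs) (sg * f z).
Proof.
move=> sg2; elim: rs => [|z rs ih]; first by rewrite !big_nil mulr1.
rewrite !big_cons ih /= exprS -[LHS]mul1r -sg2; ring.
Qed.

(** Each factor grows at least by the ratio 1 + t / D; Bernoulli's inequality
    bounds the product of these ratios. *)
Lemma prod_shift_ge (us : seq R) (D t : R) : 0 < D -> 0 <= t ->
  all (fun u => 0 <= u <= D) us ->
  (\prod_(u <- us) u) * (1 + (size us)%:R * t / D) <= \prod_(u <- us) (u + t).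
Proof.
move=> D0 t0; elim: us => [|u us ih] /=.
  by rewrite !big_nil mul0r mul0r addr0 mulr1.
move=> /andP[/andP[u0 uD] us0]; rewrite !big_cons; have {}ih := ih us0.
have p0 : 0 <= \prod_(v <- us) v.
  rewrite big_seq prodr_ge0 // => v /(allP us0) /andP[] //.
have tD : 0 <= t / D by rewrite divr_ge0 // ltW.
apply: (@le_trans _ _ (u * (1 + t / D) * ((\prod_(v <- us) v) * (1 + (size us)%:R * t / D)))).
  rewrite mulrACA ler_wpM2l ?mulr_ge0 // -natr1.
  have : 0 <= (size us)%:R * t / D by rewrite -mulrA mulr_ge0.
  rewrite -!mulrA; move: (size us)%:R (t / D) tD => n v v0 nv; nra.
apply: ler_pM => //.
- by rewrite mulr_ge0 // addr_ge0.
- by rewrite mulr_ge0 // addr_ge0 // -mulrA mulr_ge0.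
- rewrite mulrDr mulr1 lerD2l mulrA ler_pdivrMr // mulrC.
  by rewrite ler_wpM2l.
Qed.

End RealRooted.

Section Julia.
Context {R : realType}.
Local Notation C := R[i].

Lemma escapeE (u : nat -> R) :
  (u n @[n --> \oo] --> +oo) <-> forall A, exists M, forall n, (M <= n)%N -> A <= u n.
Proof.
split=> [/cvgryPge h A|h].
  by have [M _ hM] := h A; exists M => n Mn; exact: hM.
by apply/cvgryPge => A; have [M hM] := h A; exists M.
Qed.

Lemma julia_horner (f : {poly C}) z : julia f f.[z] <-> julia f z.
Proof.
rewrite /julia /=; apply/not_iff_compat; rewrite !escapeE; split=> h A.
  have [M hM] := h A; exists M.+1 => -[//|n] Mn.
  by rewrite iterSr; exact: hM.
by have [M hM] := h A; exists M => n Mn; rewrite -iterSr; apply: hM; exact: leqW.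
Qed.

Lemma bounded_orbit_julia (f : {poly C}) (B : R) z :
  (forall n, modulus (iter n (fun w => f.[w]) z) <= B) -> julia f z.
Proof.
move=> hB /escapeE /(_ (B + 1)) [M /(_ M (leqnn _))].
by apply/negP; rewrite -ltNge; apply: le_lt_trans (hB M) _; rewrite ltrDl.
Qed.

End Julia.

Section Hull.
(* [Jr] stands for the set of real points of the Julia set of [F]. *)
Context {R : realType} (F : {poly R}) (N : nat) (xi : R) (Jr : set R).
Hypotheses (N_ge2 : (2 <= N)%N) (sizeF : size F = N.+1)
  (real_rooted : forall y, `|y| <= xi -> exists2 rs : seq R, size rs = N &
     F - y%:P = lead_coef F *: \prod_(z <- rs) ('X - z%:P))
  (Jr0 : Jr !=set0) (Jr_xi : forall x, Jr x -> `|x| <= xi)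
  (Jr_F : forall x, Jr F.[x] <-> Jr x)
  (Jr_orbit : forall x, (forall n, `|iter n (fun w => F.[w]) x| <= xi) -> Jr x)
  (Jr_crit : forall c, root F^`() c -> ~ Jr c).

Local Notation alpha := (lead_coef F).
Local Notation a := (inf Jr).
Local Notation b := (sup Jr).

Let alpha_neq0 : alpha != 0. Proof. by rewrite lead_coef_eq0 -size_poly_eq0 sizeF. Qed.

Let ubJ : has_sup Jr.
Proof. by split => //; exists xi => x /Jr_xi /ler_normlP[]. Qed.

Let lbJ : has_inf Jr.
Proof. by split => //; exists (- xi) => x /Jr_xi /ler_normlP[? ?]; rewrite lerNl. Qed.

Lemma hull_itv x : Jr x -> a <= x <= b.
Proof.
move=> Jx; rewrite (ub_le_sup ubJ.2) //= andbT.
exact: ge_inf lbJ.2 _ Jx.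
Qed.

Lemma Jr_iter n x : Jr x -> Jr (iter n (fun w => F.[w]) x).
Proof. by move=> Jx; elim: n => //= n ih; apply/Jr_F. Qed.

Lemma iter_horner n x : iter n (fun w => F.[w]) x = (iterp F n).[x].
Proof.
elim: n x => [|n ih] x; first by rewrite hornerX.
by rewrite iterSr ih /iterp iterS horner_comp.
Qed.

(** At a limit of points of [Jr], continuity of each iterate keeps the orbit within
    [-xi, xi]. *)
Lemma Jr_closed c : (forall e, 0 < e -> exists2 x, Jr x & `|x - c| < e) -> Jr c.
Proof.
move=> hc; apply: Jr_orbit => n; rewrite leNgt; apply/negP => big.
have e0 : 0 < `|iter n (fun w => F.[w]) c| - xi by rewrite subr_gt0.
have [e e_gt0 he] := poly_cont c (iterp F n) e0.
have [x Jx xc] := hc e e_gt0; have := he x xc; have := Jr_xi (Jr_iter n Jx).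
rewrite -iter_horner -(iter_horner n c) => h1.
have := lerB_dist (iter n (fun w => F.[w]) c) (iter n (fun w => F.[w]) x).
by rewrite distrC; lra.
Qed.

Lemma Jr_sup : Jr b.
Proof.
apply: Jr_closed => e e0; have [x Jx bx] := sup_adherent e0 ubJ.
exists x => //; have /andP[_ xb] := hull_itv Jx.
by rewrite distrC ger0_norm; lra.
Qed.

Lemma Jr_inf : Jr a.
Proof.
apply: Jr_closed => e e0; have [x Jx ax] := inf_adherent e0 lbJ.
exists x => //; have /andP[xa _] := hull_itv Jx.
by rewrite ger0_norm; lra.
Qed.

Lemma hull_roots y : Jr y -> exists rs : seq R,
  [/\ size rs = N, F - y%:P = alpha *: \prod_(z <- rs) ('X - z%:P) & forall z, z \in rs -> Jr z].
Proof.
move=> Jy; have [rs srs Frs] := real_rooted (Jr_xi Jy); exists rs; split => // z zrs.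
apply/Jr_F; suff -> : F.[z] = y by [].
apply/eqP; rewrite -subr_eq0 -[y in _ - y](hornerC y z) -hornerN -hornerD Frs hornerZ mulf_eq0.
apply/orP; right; rewrite horner_prod prodf_seq_eq0; apply/hasP; exists z => //.
by rewrite hornerXsubC subrr eqxx.
Qed.

Lemma horner_roots (rs : seq R) y x : F - y%:P = alpha *: \prod_(z <- rs) ('X - z%:P) ->
  F.[x] - y = alpha * \prod_(z <- rs) (x - z).
Proof.
move=> /(congr1 (fun p => p.[x])); rewrite hornerD hornerN hornerC hornerZ horner_prod => ->.
by congr (_ * _); apply: eq_bigr => z _; rewrite hornerXsubC.
Qed.

(** A double root would be a critical point in [Jr]. *)
Lemma roots_uniq (rs : seq R) y : F - y%:P = alpha *: \prod_(z <- rs) ('X - z%:P) ->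
  (forall z, z \in rs -> Jr z) -> uniq rs.
Proof.
move=> Frs Jrs; apply: count_mem_uniq => z.
have [zrs|/count_memPn//] := boolP (z \in rs).
have h1 := perm_to_rem zrs; rewrite (permP h1) /= eqxx.
have [zrem|/count_memPn->//] := boolP (z \in rem z rs).
have h2 := perm_to_rem zrem; exfalso; apply: (Jr_crit (c := z)); last exact: Jrs.
have -> : F^`() = (F - y%:P)^`() by rewrite derivB derivC subr0.
rewrite Frs (perm_big _ h1) /= big_cons (perm_big _ h2) /= big_cons rootE.
rewrite derivZ derivM derivXsubC derivM derivXsubC.
rewrite !(hornerXsubC, hornerZ, hornerD, hornerM) subrr !mul0r.
by rewrite !(mul0r, addr0, mulr0).
Qed.

Lemma hull_lt : a < b.
Proof.
have [rs [srs Frs Jrs]] := hull_roots Jr_inf.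
have u := roots_uniq Frs Jrs.
case: rs srs Frs Jrs u => [|z1 [|z2 rs]] srs _ Jrs; [by move: N_ge2; rewrite -srs..|].
rewrite /= inE => /andP[/norP[z12 _] _].
have /andP[h1 h2] := hull_itv (Jrs z1 (mem_head _ _)).
have /andP[h3 h4] : a <= z2 <= b by apply/hull_itv/Jrs; rewrite !inE eqxx orbT.
by case: (ltgtP z1 z2) z12 => // ? _; lra.
Qed.

(** F - a and F - b are real-rooted. If F c were strictly between a and b,
    Laguerre's inequality at the critical point c would give F'' c opposite
    strict signs. *)
Lemma crit_value_outside c : root F^`() c -> F.[c] < a \/ b < F.[c].
Proof.
move=> c0; case: (ltP F.[c] a) => [|ac]; first by left.
case: (ltP b F.[c]) => [|cb]; first by right.
have Fca : F.[c] != a.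
  by apply/eqP => e; apply: (Jr_crit c0); apply/Jr_F; rewrite e; exact: Jr_inf.
have Fcb : F.[c] != b.
  by apply/eqP => e; apply: (Jr_crit c0); apply/Jr_F; rewrite e; exact: Jr_sup.
have lag y : Jr y -> F.[c] != y -> 0 < - ((F.[c] - y) * F^`()^`().[c]).
  move=> Jy Fy; have [rs [srs Frs _]] := hull_roots Jy.
  have rs0 : rs != [::] by rewrite -size_eq0 srs -lt0n ltnW.
  have := @laguerre_gt0 _ alpha rs c rs0; rewrite -Frs /laguerre derivB derivC subr0.
  rewrite (eqP c0) expr0n sub0r hornerD hornerN hornerC; apply.
  by rewrite subr_eq0.
have := lag _ Jr_inf Fca; have := lag _ Jr_sup Fcb.
have h1 : F.[c] - b < 0 by rewrite subr_lt0 lt_neqAle Fcb.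
have h2 : 0 < F.[c] - a by rewrite subr_gt0 lt_neqAle eq_sym Fca.
rewrite !oppr_gt0 nmulr_rlt0 // pmulr_rlt0 //; lra.
Qed.

(** The end [e] is the right one if [sg = 1] and the left one if [sg = -1]. It is
    mapped to a or b, and all roots of F - a and of F - b lie on the same side
    of [e]; moving away from them by t increases both products of distances as in
    [prod_shift_ge]. *)
Lemma hull_end (sg e t : R) : sg * sg = 1 -> Jr e ->
  (forall x, Jr x -> 0 <= sg * (e - x) <= b - a) -> 0 <= t ->
  b + N%:R * t <= F.[e + sg * t] \/ F.[e + sg * t] <= a - N%:R * t.
Proof.
move=> sg2 Je side t0; have ab := hull_lt.
have D0 : 0 < b - a by rewrite subr_gt0.
pose be := alpha * sg ^+ N.
have end_eq y : Jr y -> exists U V : R, [/\ 0 <= U, U * (1 + N%:R * t / (b - a)) <= V,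
    F.[e] - y = be * U & F.[e + sg * t] - y = be * V].
  move=> Jy; have [rs [srs Frs Jrs]] := hull_roots Jy.
  pose us := [seq sg * (e - z) | z <- rs].
  have us_bnd : all (fun u => 0 <= u <= b - a) us.
    by apply/allP => _ /mapP[z zrs ->]; exact/side/Jrs.
  exists (\prod_(u <- us) u), (\prod_(u <- us) (u + t)); split.
  - by rewrite big_seq prodr_ge0 // => u /(allP us_bnd) /andP[].
  - by have := prod_shift_ge D0 t0 us_bnd; rewrite size_map srs.
  - by rewrite (horner_roots e Frs) /be -mulrA big_map (prod_sign _ _ sg2) srs.
  - rewrite (horner_roots _ Frs) /be -mulrA (prod_sign _ _ sg2) srs big_map.
    congr (_ * (_ * _)); apply: eq_bigr => z _.
    by rewrite -addrAC mulrDr mulrA sg2 mul1r.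
have [Ua [Va [Ua0 UVa Ea Ea']]] := end_eq _ Jr_inf.
have [Ub [Vb [Ub0 UVb Eb Eb']]] := end_eq _ Jr_sup.
have /andP[ea eb] : a <= F.[e] <= b by apply/hull_itv/Jr_F.
have dN (x : R) : x * (1 + N%:R * t / (b - a)) = x + x / (b - a) * (N%:R * t).
  by field; rewrite gt_eqF.
(* a <= F e <= b makes this product <= 0, while it equals be^2 U_a U_b >= 0 *)
have : (F.[e] - a) * (F.[e] - b) = 0.
  apply/eqP; rewrite eq_le mulr_ge0_le0 ?subr_ge0 ?subr_le0 //= Ea Eb mulrACA.
  by rewrite -expr2 mulr_ge0 ?sqr_ge0 // mulr_ge0.
move/eqP; rewrite mulf_eq0 !subr_eq0 => /orP[/eqP Fe|/eqP Fe].
  right; rewrite Fe in Eb; have be0 : be < 0.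
    have : be * Ub < 0 by rewrite -Eb subr_lt0.
    by rewrite !ltNge; apply: contra => be0; rewrite mulr_ge0.
  have := ler_wnM2l (ltW be0) UVb; rewrite mulrA -Eb -Eb' dN.
  have -> : (a - b) / (b - a) = -1 by field; rewrite gt_eqF.
  by lra.
left; rewrite Fe in Ea; have be0 : 0 < be.
  have : 0 < be * Ua by rewrite -Ea.
  by rewrite !ltNge; apply: contra => be0; rewrite mulr_le0_ge0.
have := ler_wpM2l (ltW be0) UVa; rewrite mulrA -Ea -Ea' dN divff ?gt_eqF //.
by lra.
Qed.

Local Notation m := ((a + b) / 2).
Local Notation r0 := ((b - a) / 2).

Lemma end_right t : 0 <= t -> r0 + N%:R * t <= `|F.[b + t] - m|.
Proof.
move=> t0; have [||h|h] := @hull_end 1 b t _ Jr_sup _ t0; first by rewrite mulr1.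
- by move=> x /hull_itv /andP[? ?]; rewrite mul1r; apply/andP; split; lra.
- by rewrite ler_normr; apply/orP; left; rewrite mul1r in h; lra.
- by rewrite ler_normr; apply/orP; right; rewrite mul1r in h; lra.
Qed.

Lemma end_left t : 0 <= t -> r0 + N%:R * t <= `|F.[a - t] - m|.
Proof.
move=> t0; have [||h|h] := @hull_end (-1) a t _ Jr_inf _ t0; first by rewrite mulrNN mulr1.
- by move=> x /hull_itv /andP[? ?]; rewrite mulN1r; apply/andP; split; lra.
- by rewrite ler_normr; apply/orP; left; rewrite mulN1r in h; lra.
- by rewrite ler_normr; apply/orP; right; rewrite mulN1r in h; lra.
Qed.

Lemma hull_inv l : `|F.[l] - m| <= r0 -> `|l - m| <= r0.
Proof.
have N0 : 0 < N%:R :> R by rewrite ltr0n ltnW.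
move=> Fl; rewrite ler_norml; apply/andP; split; rewrite leNgt; apply/negP => h.
  have t0 : 0 < a - l by lra.
  have := end_left (ltW t0); have -> : a - (a - l) = l by ring.
  by have := mulr_gt0 N0 t0; lra.
have t0 : 0 < l - b by lra.
have := end_right (ltW t0); have -> : b + (l - b) = l by ring.
by have := mulr_gt0 N0 t0; lra.
Qed.

Lemma finite_gap (g : nat -> R) n : (forall k, 0 < g k) ->
  exists2 e, 0 < e & forall k, (k < n)%N -> e <= g k.
Proof.
move=> g0; elim: n => [|n [e e0 he]]; first by exists 1.
exists (Num.min e (g n)); first by rewrite lt_min e0 g0.
move=> k; rewrite ltnS leq_eqVlt => /orP[/eqP->|kn]; first by rewrite ge_min lexx orbT.
by rewrite ge_min he.
Qed.

(** The bands are separated by the critical points that Rolle's theorem puts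
    between consecutive roots of F - a; their values lie outside [a, b] by some margin e
    ([crit_value_outside]). The two extreme points are taken at distance e / 2
    outside the hull, where [hull_end] gives the margin N e / 2 >= e. *)
Lemma hull_bands : exists m r0 r rho s, expanding_bands F N m r0 r rho s /\
  forall x, Jr x -> `|x - m| <= r0.
Proof.
have ab := hull_lt.
have [rs [srs Frs Jrs]] := hull_roots Jr_inf.
pose L := sort <=%R rs; pose l := nth 0 L.
have sL : size L = N by rewrite size_sort.
have l_lt i j : (i < j)%N -> (j < N)%N -> l i < l j.
  have Lsort : sorted <%R L.
    by rewrite lt_sorted_uniq_le sort_uniq (roots_uniq Frs Jrs) sort_le_sorted.
  move=> ij jN; rewrite /l lt_sorted_ltn_nth // inE sL //.
  exact: ltn_trans jN.
have l_hull i : (i < N)%N -> a <= l i <= b.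
  by move=> iN; apply/hull_itv/Jrs; rewrite -(mem_sort <=%R) mem_nth // sL.
have FE x : F.[x] - a = alpha * \prod_(j < N) (x - l j).
  rewrite (horner_roots x Frs); congr (_ * _).
  have LP : perm_eq L rs by rewrite perm_sort.
  by rewrite -(perm_big _ LP) /= (big_nth 0) sL big_mkord.
have l_root i : (i < N)%N -> F.[l i] = a.
  move=> iN; apply/eqP; rewrite -subr_eq0 FE (bigD1 (Ordinal iN)) //= subrr.
  by rewrite mul0r mulr0.
have /choice[c hc] : forall k, exists c, (0 < k < N)%N -> l k.-1 < c < l k /\ root F^`() c.
  move=> k; have [/andP[k0 kN]|] := boolP (0 < k < N)%N; last by exists 0.
  have pk : (k.-1 < k)%N by rewrite prednK.
  have [|c] := @poly_rolle _ (l k.-1) (l k) F (l_lt _ _ pk kN).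
    by rewrite !l_root // (ltn_trans pk).
  by rewrite in_itv /= => hc /eqP c0; exists c.
pose g k := if (0 < k < N)%N then `|F.[c k] - m| - r0 else 1.
have g_gt0 k : 0 < g k.
  rewrite /g; case: ifP => // kN; have [_ ck] := hc k kN.
  rewrite subr_gt0 lter_normr; have [h|h] := crit_value_outside ck; apply/orP; [right|left]; lra.
have [e e0 he] := finite_gap N g_gt0.
pose s k := if k == 0%N then a - e / 2 else if k == N then b + e / 2 else c k.
have e2 : 0 < e / 2 by rewrite divr_gt0.
have s_bet k : (k < N)%N -> s k < l k < s k.+1.
  move=> kN; have /andP[h1 h2] := l_hull k kN; apply/andP; split; rewrite /s.
    have [k0|k0] := eqVneq k 0%N; first by lra.
    by rewrite (ltn_eqF kN); have [|/andP[_ ->]] := hc k; rewrite ?lt0n ?k0.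
  rewrite /=; have [kN'|kN'] := eqVneq k.+1 N; first by lra.
  have [|/andP[h _] _] := hc k.+1; last exact: h.
  by rewrite [(_ < N)%N]ltn_neqAle kN' kN.
have s_big k : (k <= N)%N -> r0 + e <= `|F.[s k] - m|.
  have N2 : r0 + e <= r0 + N%:R * (e / 2).
    have : 2 <= N%:R :> R by rewrite (ler_nat _ 2).
    move=> h; rewrite lerD2l [leLHS](_ : e = 2 * (e / 2)); last by field.
    by rewrite ler_wpM2r ?(ltW e2).
  move=> kN; rewrite /s; have [k0|k0] := eqVneq k 0%N.
    exact: le_trans N2 (end_left (ltW e2)).
  have [kN'|kN'] := eqVneq k N; first exact: le_trans N2 (end_right (ltW e2)).
  have k_lt : (k < N)%N by rewrite ltn_neqAle kN'.
  by have := he k k_lt; rewrite /g lt0n k0 k_lt /=; lra.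
have l_le i j : (i <= j)%N -> (j < N)%N -> l i <= l j.
  by rewrite leq_eqVlt => /orP[/eqP->//|ij jN]; exact/ltW/l_lt.
have s_alt k : (k < N)%N -> (F.[s k] - a) * (F.[s k.+1] - a) < 0.
  move=> kN; rewrite !FE mulrACA -expr2 pmulr_rlt0 ?exprn_even_gt0 //.
  rewrite -big_split /= (bigD1 (Ordinal kN)) //=; have /andP[h1 h2] := s_bet k kN.
  rewrite pmulr_llt0; first by rewrite nmulr_rlt0 ?subr_lt0 ?subr_gt0.
  apply: prodr_gt0 => j /negPf jk; case: (ltngtP j k) => [ltjk|ltkj|e']; last first.
  - by move: jk; rewrite -val_eqE /= e' eqxx.
  - have /andP[h3 _] := s_bet k.+1 (leq_ltn_trans ltkj (ltn_ord j)).
    have := l_le _ _ ltkj (ltn_ord j) => h4.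
    by rewrite nmulr_rgt0 ?subr_lt0; lra.
  - have pk : (k.-1 < N)%N by rewrite (leq_ltn_trans (leq_pred _)).
    have /andP[_ h3] := s_bet k.-1 pk; rewrite prednK ?(leq_ltn_trans (leq0n j)) // in h3.
    have h4 : l j <= l k.-1 by apply: l_le => //; rewrite -ltnS prednK ?(leq_ltn_trans (leq0n j)).
    by rewrite mulr_gt0 // subr_gt0; lra.
exists m, r0, (r0 + e / 2), (r0 + e), s; split; last first.
  by move=> x /hull_itv; rewrite ler_norml; lra.
split=> //; try lra.
- exact: ltnW.
- rewrite /s eqxx; lra.
- rewrite /s eqxx; case: eqP => [N0|_]; last lra.
  by move: N_ge2; rewrite N0.
- by move=> k kN; have /andP[h1 h2] := s_bet k kN; exact: lt_trans h2.
- move=> k kN; have := s_alt k kN; have := s_big k (ltnW kN); have := s_big k.+1 kN.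
  rewrite !ler_normr; case: (ltrgt0P (F.[s k] - a)) => [u0|u0|->]; last by rewrite mul0r ltxx.
    move=> h1 h2; rewrite pmulr_rlt0 // => v0.
    by rewrite pmulr_rlt0; case/orP: h1 => ?; case/orP: h2 => ?; lra.
  move=> h1 h2; rewrite nmulr_rlt0 // => v0.
  by rewrite nmulr_rlt0; case/orP: h1 => ?; case/orP: h2 => ?; lra.
- exact: hull_inv.
Qed.

End Hull.

(** * Reduction to a real polynomial *)

Section RealForm.
Context {R : realType}.
Local Notation C := R[i].
Local Notation toC := (map_poly (real_complex R)).

Lemma real_split (f : {poly C}) N (xi y : R) : (0 < N)%N -> size f = N.+1 ->
  (fun z => f.[z]) @^-1` real_segment xi `<=` real_segment xi -> `|y| <= xi ->
  exists2 rs : seq R, size rs = N &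
    f - y%:C%:P = lead_coef f *: toC (\prod_(z <- rs) ('X - z%:P)).
Proof.
move=> N0 sf pre yxi; have [r fr] := closed_field_poly_normal (f - y%:C%:P).
have sy : (size (- (y%:C%:P : {poly C})) < size f)%N.
  by rewrite size_polyN sf (leq_ltn_trans (size_polyC_leq1 _)).
have r_real z : z \in r -> z = (re z)%:C.
  move=> zr; have fz : f.[z] = y%:C.
    suff : (f - y%:C%:P).[z] = 0 by rewrite hornerD hornerN hornerC => /subr0_eq.
    have /rootP pz : root (\prod_(w <- r) ('X - w%:P)) z by rewrite root_prod_XsubC.
    by rewrite fr hornerZ pz mulr0.
  have [|x _ <-//] := pre z; rewrite /= fz; exists y => //=.
  by rewrite -ler_norml.
have rE : r = [seq (re z)%:C | z <- r].
  by rewrite -[LHS]map_id; apply/eq_in_map => z /r_real.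
exists [seq re z | z <- r].
  rewrite size_map; have := congr1 (fun p : {poly C} => size p) fr.
  rewrite /= size_polyDl // sf lead_coefDl // size_scale ?lead_coef_eq0 -?size_poly_eq0 ?sf //.
  by rewrite size_prod_XsubC => -[].
rewrite fr lead_coefDl //; congr (_ *: _); rewrite rmorph_prod /= big_map {1}rE big_map.
by apply: eq_bigr => z _; rewrite map_polyXsubC.
Qed.

(** Since f - xi and f + xi split over the real numbers, comparing their constant
    terms expresses the leading coefficient as a quotient of real numbers. *)
Lemma real_form (f : {poly C}) N (xi : R) : (0 < N)%N -> size f = N.+1 -> 0 < xi ->
  (fun z => f.[z]) @^-1` real_segment xi `<=` real_segment xi ->
  exists F : {poly R}, f = toC F /\ forall y, `|y| <= xi ->
    exists2 rs : seq R, size rs = N & F - y%:P = lead_coef F *: \prod_(z <- rs) ('X - z%:P).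
Proof.
move=> N0 sf xi0 pre.
have xi_xi : `|xi| <= xi by rewrite gtr0_norm.
have [r1 _ f1] := real_split N0 sf pre xi_xi.
have Nxi_xi : `|- xi| <= xi by rewrite normrN.
have [r2 _ f2] := real_split N0 sf pre Nxi_xi.
move: f1 f2; set P1 := \prod_(z <- r1) _; set P2 := \prod_(z <- r2) _ => f1 f2.
have lf : lead_coef f = (2 * xi / (P2`_0 - P1`_0))%:C.
  have h : lead_coef f * (P2`_0 - P1`_0)%:C = (2 * xi)%:C.
    have h1 : f`_0 - xi%:C = lead_coef f * (P1`_0)%:C.
      by rewrite -[xi%:C](coefC _ 0) -coefB f1 coefZ coef_map.
    have h2 : f`_0 - (- xi)%:C = lead_coef f * (P2`_0)%:C.
      by rewrite -[(- xi)%:C](coefC _ 0) -coefB f2 coefZ coef_map.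
    rewrite rmorphB mulrBr /= -h1 -h2 rmorphN rmorphM rmorph_nat /=; ring.
  have d0 : (P2`_0 - P1`_0)%:C != 0.
    apply/eqP => d0; move: h; rewrite d0 mulr0 => /esym/complexI/eqP.
    by rewrite gt_eqF // mulr_gt0.
  by rewrite real_complex_div -h mulfK.
set al := 2 * xi / _ in lf; pose F := al *: P1 + xi%:P.
have fF : f = toC F.
  rewrite /F rmorphD /= map_polyZ /= map_polyC /= -lf -f1.
  by rewrite subrK.
exists F; split => // y yxi; have [rs srs fr] := real_split N0 sf pre yxi.
exists rs => //; apply: (@map_poly_inj _ _ (real_complex R)).
rewrite rmorphB /= map_polyZ /= map_polyC /= -fF fr; congr (_ *: _).
by rewrite fF lead_coef_map.
Qed.

Lemma hyperbolic_bands (f : {poly C}) N (xi : R) (z0 : C) :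
  (2 <= N)%N -> size f = N.+1 -> normalized f xi -> hyperbolic f -> julia f z0 ->
  exists F m r0 r rho s, [/\ f = toC F, expanding_bands F N m r0 r rho s &
    forall z, julia f z -> exists2 x, z = x%:C & `|x - m| <= r0].
Proof.
move=> N2 sf [xi0 Jxi pre] hyp Jz0.
have [F [fF roots]] := real_form (ltnW N2) sf xi0 pre.
have sF : size F = N.+1 by rewrite -sf fF size_map_poly.
have fx x : f.[x%:C] = F.[x]%:C by rewrite fF horner_map.
have itx n x : iter n (fun w => f.[w]) x%:C = (iter n (fun w => F.[w]) x)%:C.
  by elim: n => //= n ->; rewrite fx.
pose Jr : set R := [set x | julia f x%:C].
have Jreal z : julia f z -> exists2 x, z = x%:C & Jr x.
  by move=> Jz; have [x _ xz] := Jxi _ Jz; exists x; rewrite // /Jr /= xz.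
have [|||||m [r0 [r [rho [s [bands core]]]]]] := @hull_bands R F N xi Jr N2 sF roots.
- by have [x _ Jx] := Jreal _ Jz0; exists x.
- by move=> x /Jxi [x' /= hx' /complexI <-]; rewrite ler_norml.
- by move=> x; rewrite /Jr /= -fx; exact: julia_horner.
- move=> x hx; apply: (@bounded_orbit_julia _ _ xi) => n.
  by rewrite itx modulus_real.
- move=> c c0; apply: hyp; move: c0; rewrite !rootE fF deriv_map horner_map fmorph_eq0.
  by [].
exists F, m, r0, r, rho, s; split => // z /Jreal [x -> Jx].
by exists x => //; exact: core.
Qed.

End RealForm.

(** * Comparison of the weights *)

Section WeightEstimates.
Context {R : realType}.

Lemma powR_ratio_le (t c a b : R) : 0 <= t <= 2 -> 0 <= c -> 0 < a -> 0 < b ->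
  a <= expR c * b -> b `^ (- t) <= expR (2 * c) * a `^ (- t).
Proof.
move=> /andP[t0 t2] c0 a0 b0 ab; rewrite !powRN.
have at0 : 0 < a `^ t by exact: powR_gt0.
have bt0 : 0 < b `^ t by exact: powR_gt0.
rewrite ler_pdivlMr // mulrC ler_pdivrMr // mulrC.
apply: (@le_trans _ _ ((expR c * b) `^ t)).
  by apply: ge0_ler_powR; rewrite ?nnegrE ?mulr_ge0 ?expR_ge0 // ltW.
rewrite powRM ?expR_ge0 ?(ltW b0) // -expRM [leRHS]mulrC ler_wpM2r ?(ltW bt0) //.
by rewrite ler_expR mulrC ler_wpM2r.
Qed.

(** If b >= a, (b / a)^(t / 2) <= b / a because t <= 2. *)
Lemma sqrt_powR_ratio_le (t a b : R) : 0 <= t <= 2 -> 0 < a -> 0 < b ->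
  Num.sqrt (a `^ (- t)) / Num.sqrt (b `^ (- t)) <= Num.max 1 (b / a).
Proof.
move=> /andP[t0 t2] a0 b0; set M := Num.max 1 _.
have M1 : 1 <= M by rewrite le_max lexx.
have M0 : 0 <= M by exact: le_trans M1.
have sb : 0 < Num.sqrt (b `^ (- t)) by rewrite sqrtr_gt0 powR_gt0.
rewrite ler_pdivrMr // -(ger0_norm M0) -sqrtr_sqr -sqrtrM ?sqr_ge0 //.
rewrite ler_sqrt ?mulr_ge0 ?sqr_ge0 ?powR_ge0 // !powRN.
have at0 : 0 < a `^ t by exact: powR_gt0.
have bt0 : 0 < b `^ t by exact: powR_gt0.
rewrite ler_pdivlMr // mulrC ler_pdivrMr // mulrC.
have -> : b = b / a * a by rewrite divfK // gt_eqF.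
rewrite powRM ?divr_ge0 ?(ltW a0) ?(ltW b0) // mulrC ler_wpM2r ?(ltW at0) //.
apply: (@le_trans _ _ (M `^ t)).
  apply: ge0_ler_powR; rewrite ?nnegrE ?divr_ge0 ?(ltW a0) ?(ltW b0) //.
  by rewrite le_max lexx orbT.
by rewrite -(powR_mulrn 2 M0); apply: ler_powR.
Qed.

Lemma expR_diff_le (c d : R) : 0 <= c -> c <= d -> expR c - expR (- c) <= 2 * expR d * c.
Proof.
move=> c0 cd; have -> : expR (- c) = expR c * expR (- (2 * c)).
  by rewrite -expRD; congr expR; ring.
have h := expR_ge1Dx (- (2 * c)).
apply: (@le_trans _ _ (expR c * (2 * c))).
  rewrite -[X in X - _]mulr1 -mulrBr ler_wpM2l ?expR_ge0 //; lra.
have -> : 2 * expR d * c = expR d * (2 * c) by ring.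
by rewrite ler_wpM2r ?mulr_ge0 // ler_expR.
Qed.

End WeightEstimates.

Section Comparison.
Context {R : realType} (F : {poly R}) (N : nat) (m r0 r rho : R) (s : nat -> R).
Context (H : expanding_bands F N m r0 r rho s) (t : R) (t02 : 0 <= t <= 2).
Local Notation theta := (r / (rho * N%:R)).
Local Notation core y := (`|y - m| <= r0).
Local Notation point := (point F s).
Local Notation slope := (slope F s).

Definition mass n (x : R) (w : word N n) : R := `|slope w x| `^ (- t).
Definition total_mass n x : R := \sum_(w : word N n) mass x w.
Definition weight n x (w : word N n) : R := mass x w / total_mass n x.

Lemma mass_gt0 n x (w : word N n) : core x -> 0 < mass x w.
Proof. by move=> xc; rewrite powR_gt0 // normr_gt0 (slope_neq0 H). Qed.

Lemma word_inhabited n : exists w : word N n, True.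
Proof.
elim: n => [|n [w _]]; first by exists tt.
by exists (Ordinal (bands_N H), w).
Qed.

Lemma total_mass_gt0 n x : core x -> 0 < total_mass n x.
Proof.
move=> xc; have [w _] := word_inhabited n.
rewrite /total_mass (bigD1 w) //= ltr_pwDl ?mass_gt0 // sumr_ge0 // => v _.
exact/ltW/mass_gt0.
Qed.

Lemma weight_gt0 n x (w : word N n) : core x -> 0 < weight x w.
Proof. by move=> xc; rewrite divr_gt0 ?mass_gt0 ?total_mass_gt0. Qed.

(** With u = B |x - y|, slopes at x and y agree up to exp (2 u), masses and total
    masses up to exp (4 u), weights up to exp (8 u). For k = l both terms lie within
    exp (5 u) and exp (- 5 u), so their difference is O(|x - y|). For k <> l each
    term is small by [kernel_bound]: the square root of the quotient of weights
    is at most a constant times the larger of 1 and |slope l y| / |slope k x|, and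
    either alternative leaves the inverse of one of the two slopes. *)
Lemma weight_comparison : exists2 A, 0 <= A & forall n (k l : word N n) x y,
  core x -> core y -> x != y ->
  `|Num.sqrt (weight x k) / Num.sqrt (weight y l) *
      ((x - y) / (slope l y * (point k x - point l y)))
    - Num.sqrt (weight y l) / Num.sqrt (weight x k) *
      ((y - x) / (slope k x * (point l y - point k x)))|
  <= A * `|x - y| * theta ^+ depth k l.
Proof.
have [B B0 hB] := distortion H; have [K K0 hK] := kernel_bound H.
have r0_ge0 := bands_r0 H.
pose D := 10 * B * expR (10 * B * r0) + 2 * (expR (4 * B * r0) * K).
exists D; first by rewrite addr_ge0 ?mulr_ge0 ?expR_ge0.
move=> n k l x y xc yc xy.
have xy_le : `|x - y| <= 2 * r0.
  by rewrite -(subrK m x) -addrA (le_trans (ler_normD _ _)) // (distrC m); lra.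
set u := B * `|x - y|.
have u0 : 0 <= u by rewrite mulr_ge0.
have u_le : u <= 2 * B * r0 by rewrite /u (mulrC 2) -mulrA ler_wpM2l.
pose q (w : word N n) y' z' := (y' - z') / ((point w y' - point w z') * slope w z').
have slope_le x' y' (w : word N n) : core x' -> core y' -> x' != y' -> `|x' - y'| = `|x - y| ->
    `|slope w x'| <= expR (2 * u) * `|slope w y'|.
  move=> xc' yc' xy' e.
  have /andP[q1 q2] : expR (- u) <= q w x' y' <= expR u by rewrite /u -e; exact: hB.
  have /andP[q3 q4] : expR (- u) <= q w y' x' <= expR u.
    by rewrite /u -e distrC; apply: hB; rewrite // eq_sym.
  have q_gt0 : 0 < q w x' y' by exact: lt_le_trans (expR_gt0 _) q1.
  have q'_gt0 : 0 < q w y' x' by exact: lt_le_trans (expR_gt0 _) q3.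
  have pne : point w x' - point w y' != 0.
    by apply: contraTneq q_gt0 => e'; rewrite /q e' mul0r invr0 mulr0 ltxx.
  have sl : slope w x' * q w y' x' = slope w y' * q w x' y'.
    rewrite /q -(opprB (point w x')) -(opprB x'); field.
    by rewrite !(slope_neq0 H) // pne.
  have : `|slope w x'| * q w y' x' = `|slope w y'| * q w x' y'.
    by rewrite -(gtr0_norm q'_gt0) -(gtr0_norm q_gt0) -!normrM sl.
  rewrite -(ler_pM2r q'_gt0) => ->; rewrite [expR _ * _]mulrC -mulrA ler_wpM2l //.
  apply: (le_trans q2); apply: (@le_trans _ _ (expR (2 * u) * expR (- u))).
    by rewrite -expRD ler_expR; lra.
  by rewrite ler_wpM2l ?expR_ge0.
have mass_le x' y' (w : word N n) : core x' -> core y' -> x' != y' -> `|x' - y'| = `|x - y| ->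
    mass x' w <= expR (4 * u) * mass y' w.
  move=> xc' yc' xy' e; have -> : 4 * u = 2 * (2 * u) by ring.
  apply: powR_ratio_le; rewrite ?mulr_ge0 ?normr_gt0 ?(slope_neq0 H) //.
  by apply: slope_le; rewrite // 1?eq_sym // distrC.
have total_le x' y' : core x' -> core y' -> x' != y' -> `|x' - y'| = `|x - y| ->
    total_mass n x' <= expR (4 * u) * total_mass n y'.
  by move=> *; rewrite /total_mass mulr_sumr ler_sum // => w _; exact: mass_le.
have weight_le x' y' (w : word N n) : core x' -> core y' -> x' != y' -> `|x' - y'| = `|x - y| ->
    weight x' w <= expR (8 * u) * weight y' w.
  move=> xc' yc' xy' e; rewrite /weight ler_pdivrMr ?total_mass_gt0 //.
  apply: (le_trans (mass_le _ _ _ xc' yc' xy' e)).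
  have -> : expR (8 * u) * (mass y' w / total_mass n y') * total_mass n x' =
      expR (4 * u) * mass y' w * (expR (4 * u) * total_mass n x' / total_mass n y').
    have -> : 8 * u = 4 * u + 4 * u by ring.
    by rewrite expRD; ring.
  rewrite ler_peMr ?mulr_ge0 ?expR_ge0 ?(ltW (mass_gt0 _ _)) //.
  rewrite ler_pdivlMr ?total_mass_gt0 // mul1r.
  by apply: total_le; rewrite // 1?eq_sym // distrC.
have theta_ge0 : 0 <= theta.
  by have := bands_r H; have := bands_rho H => ? ?; rewrite divr_ge0 ?mulr_ge0 ?ler0n //; lra.
have e4u : expR (2 * u) <= expR (4 * B * r0) by rewrite ler_expR; lra.
have [<-{l}|kl] := eqVneq k l.
  rewrite depthxx expr0 mulr1.
  have sqrt_le x' y' : core x' -> core y' -> x' != y' -> `|x' - y'| = `|x - y| ->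
      Num.sqrt (weight x' k) / Num.sqrt (weight y' k) <= expR (4 * u).
    move=> xc' yc' xy' e; rewrite ler_pdivrMr ?sqrtr_gt0 ?weight_gt0 //.
    rewrite -(ger0_norm (expR_ge0 (4 * u))) -sqrtr_sqr -sqrtrM ?sqr_ge0 //.
    apply: ler_wsqrtr.
    have -> : expR (4 * u) ^+ 2 = expR (8 * u).
      by rewrite expr2 -expRD; congr expR; ring.
    exact: weight_le.
  have term_itv x' y' : core x' -> core y' -> x' != y' -> `|x' - y'| = `|x - y| ->
      expR (- (5 * u)) <= Num.sqrt (weight x' k) / Num.sqrt (weight y' k) * q k x' y'
        <= expR (5 * u).
    move=> xc' yc' xy' e.
    have /andP[q1 q2] : expR (- u) <= q k x' y' <= expR u by rewrite /u -e; exact: hB.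
    have q0 : 0 <= q k x' y' by exact: le_trans (expR_ge0 _) q1.
    have a0 : 0 <= Num.sqrt (weight x' k) / Num.sqrt (weight y' k).
      by rewrite divr_ge0 ?sqrtr_ge0.
    have -> : - (5 * u) = - (4 * u) + - u by ring.
    have -> : 5 * u = 4 * u + u by ring.
    rewrite !expRD; apply/andP; split; apply: ler_pM => //; rewrite ?expR_ge0 //.
      rewrite expRN -[leRHS]invrK lef_pV2 ?posrE ?expR_gt0 ?invr_gt0 ?divr_gt0 ?sqrtr_gt0 ?weight_gt0 //.
      by rewrite invf_div; apply: sqrt_le; rewrite // 1?eq_sym // distrC.
    exact: sqrt_le.
  have /andP[t1 t2] := term_itv x y xc yc xy erefl.
  have /andP[t3 t4] : expR (- (5 * u)) <= Num.sqrt (weight y k) / Num.sqrt (weight x k) * q k y x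
        <= expR (5 * u) by apply: term_itv; rewrite // 1?eq_sym // distrC.
  rewrite ![slope k _ * _]mulrC -/(q k x y) -/(q k y x).
  apply: (@le_trans _ _ (expR (5 * u) - expR (- (5 * u)))).
    by rewrite ler_norml; lra.
  apply: (le_trans (@expR_diff_le _ _ (10 * B * r0) _ _)); [lra|lra|].
  have -> : 2 * expR (10 * B * r0) * (5 * u) = 10 * B * expR (10 * B * r0) * `|x - y|.
    by rewrite /u; ring.
  by rewrite ler_wpM2r // lerDl !mulr_ge0 ?expR_ge0.
have [kx ly] := hK n k l x y kl xc yc.
have off x' y' (k' l' : word N n) : core x' -> core y' -> x' != y' -> `|x' - y'| = `|x - y| ->
    `|slope k' x'|^-1 <= K * theta ^+ depth k l * `|point k' x' - point l' y'| ->
    `|slope l' y'|^-1 <= K * theta ^+ depth k l * `|point k' x' - point l' y'| ->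
    `|Num.sqrt (weight x' k') / Num.sqrt (weight y' l') *
      ((x' - y') / (slope l' y' * (point k' x' - point l' y')))| <=
    expR (4 * B * r0) * K * `|x - y| * theta ^+ depth k l.
  move=> xc' yc' xy' e h1 h2.
  have sk : 0 < `|slope k' x'| by rewrite normr_gt0 (slope_neq0 H).
  have sl : 0 < `|slope l' y'| by rewrite normr_gt0 (slope_neq0 H).
  move: h1 h2; set th := theta ^+ _; set p := point k' x' - _ => h1 h2.
  have p0 : 0 < `|p|.
    rewrite lt_neqAle normr_ge0 andbT eq_sym; apply/eqP => p0.
    by move: h1; rewrite p0 mulr0 leNgt invr_gt0 sk.
  have ratio : Num.sqrt (weight x' k') / Num.sqrt (weight y' l') <=
      expR (2 * u) * Num.max 1 (`|slope l' y'| / `|slope k' x'|).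
    rewrite /weight (sqrtrM _ (ltW (mass_gt0 _ xc'))) (sqrtrM _ (ltW (mass_gt0 _ yc'))).
    rewrite invfM mulrACA mulrC ler_pM ?mulr_ge0 ?divr_ge0 ?invr_ge0 ?sqrtr_ge0 //.
      rewrite -sqrtrV ?invrK; last by rewrite invr_ge0 ltW ?total_mass_gt0.
      rewrite -sqrtrM ?invr_ge0 ?(ltW (total_mass_gt0 _ xc')) //.
      rewrite -(ger0_norm (expR_ge0 (2 * u))) -sqrtr_sqr ler_sqrt ?sqr_ge0 //.
      rewrite mulrC ler_pdivrMr ?total_mass_gt0 //.
      have -> : expR (2 * u) ^+ 2 = expR (4 * u) by rewrite expr2 -expRD; congr expR; ring.
      by apply: total_le; rewrite // 1?eq_sym // distrC.
    exact: sqrt_powR_ratio_le.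
  rewrite normrM (ger0_norm (divr_ge0 (sqrtr_ge0 _) (sqrtr_ge0 _))) normrM e normfV normrM.
  have -> : expR (4 * B * r0) * K * `|x - y| * th = expR (4 * B * r0) * (K * th) * `|x - y| by ring.
  rewrite mulrCA [leRHS]mulrC ler_wpM2l //.
  rewrite ler_pdivrMr ?mulr_gt0 //.
  apply: (le_trans ratio); rewrite -[leRHS]mulrA; apply: ler_pM; rewrite ?expR_ge0 ?le_max ?ler01 //.
  rewrite [leRHS](_ : _ = K * th * `|p| * `|slope l' y'|); last by ring.
  rewrite ge_max -ler_pdivrMr // mul1r h2 /= mulrC ler_wpM2r //.
apply: (le_trans (ler_normB _ _)).
have D_ge : 2 * (expR (4 * B * r0) * K) <= D by rewrite lerDr !mulr_ge0 ?expR_ge0.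
have b1 := off x y k l xc yc xy erefl kx ly.
have b2 := off y x l k yc xc; rewrite eq_sym (distrC y) (distrC (point l y)) in b2.
have b3 := b2 xy erefl ly kx.
apply: le_trans (lerD b1 b3) _.
apply: (@le_trans _ _ (2 * (expR (4 * B * r0) * K) * (`|x - y| * theta ^+ depth k l))).
  by rewrite le_eqVlt; apply/orP; left; apply/eqP; ring.
by rewrite -[leRHS]mulrA ler_wpM2r // mulr_ge0 ?exprn_ge0.
Qed.

End Comparison.

(** * Lipschitz dependence of the Jacobi matrix *)

Lemma iterp_comp {R : realType} (F : {poly R}) n : iterp F n.+1 = F \Po iterp F n.
Proof.
elim: n => [|n ih]; first by rewrite /iterp /= comp_polyX comp_polyXr.
by rewrite -[LHS]/(iterp F n.+1 \Po F) {1}ih -comp_polyA.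
Qed.

Lemma poly_iter_map {R : realType} (F : {poly R}) n :
  poly_iter (map_poly (real_complex R) F) n = map_poly (real_complex R) (iterp F n).
Proof.
elim: n => [|n ih]; first by rewrite /poly_iter /= map_polyX.
by rewrite iterp_comp map_comp_poly -ih.
Qed.

Lemma size_iterp {R : realType} (F : {poly R}) N n : (0 < N)%N -> size F = N.+1 ->
  size (iterp F n) = (N ^ n).+1.
Proof.
move=> N0 sF; have e : (size (iterp F n)).-1 = (N ^ n)%N.
  elim: n => [|n ih]; first by rewrite size_polyX.
  by rewrite iterp_comp size_comp_poly sF ih expnS.
by rewrite -e prednK // lt0n; apply: contraTneq N0 => e'; move: e; rewrite e' => /esym/eqP;
  rewrite expn_eq0 => /andP[/eqP->].
Qed.

Section Preimages.
Context {R : realType} (F : {poly R}) (N : nat) (m r0 r rho : R) (s : nat -> R).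
Context (H : expanding_bands F N m r0 r rho s) (t : R) (n : nat) (x : R).
Hypothesis xc : `|x - m| <= r0.
Local Notation C := R[i].
Local Notation T := (map_poly (real_complex R) (iterp F n)).
Local Notation pt := (fun w : word N n => point F s w x).
Local Notation nodes := [seq (pt w)%:C | w <- enum (word N n)].

Lemma nodes_uniq : uniq nodes.
Proof.
rewrite map_inj_uniq ?enum_uniq // => u v /complexI.
exact: (point_inj H).
Qed.

Lemma horner_node w : T.[(pt w)%:C] = x%:C.
Proof. by rewrite horner_map /= (iterp_point H). Qed.

(** The words give N^n distinct roots of a polynomial of degree N^n, so that the
    complex preimages are all of this form. *)
Lemma preimage_nodes k : T.[k] = x%:C -> k \in nodes.
Proof.
move=> Tk; apply/negP => /negP nk.
have sT : size (T - x%:C%:P) = (N ^ n).+1.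
  rewrite size_polyDl ?size_map_poly (size_iterp _ (bands_N H) (bands_size H)) //.
  by rewrite size_polyN (leq_ltn_trans (size_polyC_leq1 _)) // ltnS expn_gt0 (bands_N H).
have T0 : T - x%:C%:P != 0 by rewrite -size_poly_eq0 sT.
have := @max_poly_roots _ _ (k :: nodes) T0.
rewrite sT /= nk nodes_uniq rootE !hornerE Tk subrr eqxx /= size_map -cardE card_word ltnn.
move=> X; suff : false by []; apply: X => //; apply/allP => _ /mapP[w _ ->].
by rewrite rootE !hornerE horner_node subrr.
Qed.

Lemma preimage_weight_node w : preimage_weight T t (pt w)%:C = mass F s t x w.
Proof.
by rewrite /preimage_weight deriv_map horner_map modulus_real /mass (slope_deriv H).
Qed.

Lemma preimage_measure_node w :
  preimage_measure T t x%:C (pt w)%:C = weight F s t x w.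
Proof.
rewrite /preimage_measure horner_node eqxx preimage_weight_node; congr (_ / _).
rewrite (@fsbigE _ _ _ _ _ nodes) ?nodes_uniq //.
- rewrite big_map big_enum_cond; apply: eq_big => [w'|w' _]; last exact: preimage_weight_node.
  by rewrite inE; apply/asboolP; exact: horner_node.
- by move=> _ /mapP[w' _ ->]; exact: horner_node.
- by move=> k /preimage_nodes ->.
Qed.

Lemma L2_inner_node p q :
  L2_inner (preimage_measure T t x%:C) p q = node_ip pt (weight F s t x) p q.
Proof.
rewrite /L2_inner /integral_mass (@fsbigE _ _ _ _ _ nodes) ?nodes_uniq //.
  rewrite big_map big_enum_cond; apply: eq_big => [w|w _]; first by rewrite in_setT.
  by rewrite preimage_measure_node.
move=> k _ nk; rewrite /preimage_measure; case: eqP => [/preimage_nodes|_].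
  by rewrite (negbTE nk).
by rewrite mul0r.
Qed.

(** Gram-Schmidt shows that the set from which the matrix is chosen is inhabited,
    so the chosen matrix comes from some orthonormal family. *)
Lemma jacobi_matrix_node : exists P : 'I_(N ^ n) -> {poly C},
  [/\ forall k, size (P k) = k.+1, forall k, 0 < lead_coef (P k),
      forall j k, node_ip pt (weight F s t x) (P j) (P k) = (j == k)%:R &
      forall i j, jacobi_matrix (preimage_measure T t x%:C) (N ^ n) i j =
        node_ip pt (weight F s t x) ('X * P j) (P i)].
Proof.
have : exists P : 'I_(N ^ n) -> {poly C},
  [/\ forall k, size (P k) = k.+1, forall k, 0 < lead_coef (P k) &
      forall j k, node_ip pt (weight F s t x) (P j) (P k) = (j == k)%:R].
  rewrite -(card_word N n); apply: exists_orthonormal; last exact: (point_inj H).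
  by move=> w; exact: (weight_gt0 H).
move=> [P0 [sP lP oP]].
have : exists J, [set J | exists2 P : 'I_(N ^ n) -> {poly C},
    orthonormal_polynomials (preimage_measure T t x%:C) P &
    J = multiplication_matrix (preimage_measure T t x%:C) P] J.
  eexists; exists P0; last by []; split=> // j k; rewrite L2_inner_node; exact: oP.
move=> /(xgetPex 0) [P [sP' lP' oP'] JE]; exists P; split => // [j k|i j].
  by rewrite -L2_inner_node.
by rewrite /jacobi_matrix JE mxE L2_inner_node.
Qed.

End Preimages.

Section JacobiLipschitz.
Context {R : realType} (F : {poly R}) (N : nat) (m r0 r rho : R) (s : nat -> R).
Context (H : expanding_bands F N m r0 r rho s) (t : R) (t02 : 0 <= t <= 2).
Hypothesis N2 : (2 <= N)%N.
Local Notation core y := (`|y - m| <= r0).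
Local Notation theta := (r / (rho * N%:R)).

Lemma jacobi_lipschitz : exists L, forall n x y, (1 <= n)%N -> core x -> core y ->
  let T := map_poly (real_complex R) (iterp F n) in
  operator_norm (jacobi_matrix (preimage_measure T t x%:C) (N ^ n)
    - jacobi_matrix (preimage_measure T t y%:C) (N ^ n)) <= L * `|x - y|.
Proof.
have [A A0 hA] := weight_comparison H t02.
have r0_ge0 := bands_r0 H; have r0r := bands_r H; have rrho := bands_rho H.
have rho_gt0 : 0 < rho by lra.
have N_gt0 : 0 < N%:R :> R by rewrite ltr0n (bands_N H).
have th0 : 0 <= theta by rewrite divr_ge0 ?mulr_ge0 ?(ltW N_gt0) //; lra.
have Nth : N%:R * theta < 1.
  have -> : N%:R * theta = r / rho by field; rewrite !gt_eqF.
  by rewrite ltr_pdivrMr // mul1r.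
pose S := (1 - N%:R * theta)^-1; have S0 : 0 <= S by rewrite invr_ge0 subr_ge0 ltW.
pose M := `|m| + r0; have M0 : 0 <= M by rewrite addr_ge0.
(* [jacobi_close] will be applied with eta = A |x - y| S, which is at most
   2 r0 A S on the core; M bounds the nodes. *)
exists (3 * (2 * (M * (1 + A * S * (2 * r0)) * (A * S)))) => n x y n1 xc yc /=.
have [P [sP lP oP JP]] := jacobi_matrix_node H t n xc.
have [Q [sQ lQ oQ JQ]] := jacobi_matrix_node H t n yc.
set J := (X in operator_norm X); have entries i j : J i j =
   node_ip (fun w : word N n => point F s w x) (weight F s t x) ('X * P j) (P i) -
   node_ip (fun w : word N n => point F s w y) (weight F s t y) ('X * Q j) (Q i).
  by rewrite !mxE JP JQ.
have far (i j : 'I_(N ^ n)) : (j.+1 < i)%N || (i.+1 < j)%N -> J i j = 0.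
  by rewrite entries; exact: (jacobi_close_far sP lP oP sQ lQ oQ).
pose eta := A * `|x - y| * S; have eta0 : 0 <= eta by rewrite !mulr_ge0.
have xy_le : `|x - y| <= 2 * r0.
  by rewrite -(subrK m x) -addrA (le_trans (ler_normD _ _)) // (distrC m); lra.
have unit_norm (z : R) (zc : core z) (V : 'I_(N ^ n) -> {poly R[i]}) k :
    (forall j k, node_ip (fun w : word N n => point F s w z) (weight F s t z) (V j) (V k) =
       (j == k)%:R) ->
    \sum_(w : word N n) weight F s t z w * modulus (V k).[(point F s w z)%:C] ^+ 2 <= 1.
  move=> oV; move: (oV k k); rewrite node_ip_norm eqxx => /complexI ->.
  exact: lexx.
have close i j : modulus (node_ip (fun w : word N n => point F s w x) (weight F s t x) (Q i) (P j)
    - node_ip (fun w : word N n => point F s w y) (weight F s t y) (Q i) (P j)) <= eta.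
  have [<-|xy] := eqVneq x y.
    by rewrite subrr modulus0.
  apply: (@compare_inner _ _ _ _ _ _ (iterp F n) x y (A * `|x - y|) S
    (fun u v => theta ^+ depth u v)).
  - by rewrite card_word; exact: (size_iterp _ (bands_N H) (bands_size H)).
  - exact: (point_inj H).
  - exact: (point_inj H).
  - by move=> k; exact: (iterp_point H).
  - by move=> k; exact: (iterp_point H).
  - by move=> k; rewrite -(slope_deriv H) // (slope_neq0 H).
  - by move=> k; rewrite -(slope_deriv H) // (slope_neq0 H).
  - by [].
  - by move=> k; exact: (weight_gt0 H).
  - by move=> k; exact: (weight_gt0 H).
  - by move=> k l; rewrite -!(slope_deriv H) //; exact: hA.
  - by rewrite mulr_ge0.
  - by [].
  - by move=> k l; rewrite exprn_ge0.
  - by move=> k; exact: sum_depth_le.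
  - by move=> l; under eq_bigr do rewrite depthC; exact: sum_depth_le.
  - by rewrite card_word sP ltn_ord.
  - by rewrite card_word sQ ltn_ord.
  - exact: unit_norm.
  - exact: unit_norm.
have d2 : (2 <= N ^ n)%N.
  by case: (n) n1 => // k _; rewrite expnS (leq_trans N2) // leq_pmulr // expn_gt0 (bands_N H).
apply: (le_trans (operator_norm_tridiag (eps := 2 * (M * (1 + eta) * eta)) _ _ far)).
- by rewrite !mulr_ge0 // addr_ge0.
- move=> i j; rewrite entries.
  apply: (@jacobi_close _ _ _ _ _ _ _ P Q (iterp F n) x y M eta d2) => //.
  + by move=> k; exact: (weight_gt0 H).
  + move=> k; rewrite -(subrK m (point F s k x)) (le_trans (ler_normD _ _)) //.
    by rewrite addrC lerD2l; exact: (point_core H).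
  + exact: (size_iterp _ (bands_N H) (bands_size H)).
  + by move=> k; exact: (iterp_point H).
  + by move=> k; exact: (iterp_point H).
have -> : 3 * (2 * (M * (1 + A * S * (2 * r0)) * (A * S))) * `|x - y| =
    3 * (2 * (M * (1 + A * S * (2 * r0)) * eta)) by rewrite /eta; ring.
rewrite !ler_wpM2l // ler_wpM2r // ler_wpM2l // lerD2l /eta mulrAC ler_wpM2l ?mulr_ge0 //.
Qed.

End JacobiLipschitz.

Theorem theorem1p2 (R : realType) (N : nat) (f : {poly R[i]}) (xi t : R)
  (hN : (2 <= N)%N) (hdeg : size f = N.+1)
  (hreal : julia f `<=` real_line)
  (hnorm : normalized f xi)
  (hhyp : hyperbolic f)
  (ht : 0 <= t <= 2) :
  exists K : R, forall (n : nat) (x1 x2 : R[i]), (1 <= n)%N ->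
    julia f x1 -> julia f x2 ->
    operator_norm
      (jacobi_matrix (preimage_measure (poly_iter f n) t x1) (N ^ n)
       - jacobi_matrix (preimage_measure (poly_iter f n) t x2) (N ^ n))
    <= K * modulus (x1 - x2).
Proof.
have [[z0 Jz0]|noJ] := pselect (exists z, julia f z); last first.
  by exists 0 => n x1 x2 _ Jx1; case: noJ; exists x1.
have [F [m [r0 [r [rho [s [fF bands core]]]]]]] := hyperbolic_bands hN hdeg hnorm hhyp Jz0.
have [L hL] := jacobi_lipschitz bands ht hN.
exists L => n x1 x2 n1 /core [x -> xc] /core [y -> yc].
by rewrite fF poly_iter_map -rmorphB modulus_real; exact: hL.
Qed.
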